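(* Let $M\in\mathbb{R}^{m\times n}$ be a nonzero matrix and let $f:\mathbb{R}^n\to\left]-\infty,+\infty\right]$ and $g:\mathbb{R}^m\to\left]-\infty,+\infty\right]$ be proper, lower semicontinuous and convex. Let $(\mathcal P)$ denote the problem $\min\{f(x)+g(z):Mx=z,\ x\in\mathbb{R}^n,\ z\in\mathbb{R}^m\}$. Suppose that one of the following conditions holds: (A.1) the Lagrangian $L_0$ has a saddle point (equivalently, a critical point); (A.2) problem $(\mathcal P)$ has an optimal solution and $0\in\operatorname{ri}(\operatorname{dom} g-M(\operatorname{dom} f))$; and that one of the following conditions holds: (B.1) $0\in\operatorname{ri}(\operatorname{dom} f^*-\operatorname{ran} M^T)$; (B.2) $\operatorname{ri}(\operatorname{ran}\partial f)\cap\operatorname{ran} M^T\ne\varnothing$; (B.3) $(\operatorname{rec} f)(x)>0$ for all $x\in\ker M\setminus\{x\in\mathbb{R}^n:-(\operatorname{rec} f)(-x)=(\operatorname{rec} f)(x)=0\}$; (B.4) $f$ is coercive (in particular, supercoercive); (B.5) $f$ is strongly convex; (B.6) $M^TM$ is invertible. Let $\gamma>0$, let $(x^0,z^0,y^0)\in\mathbb{R}^n\times\mathbb{R}^m\times\mathbb{R}^m$ and let $(x^k,z^k,y^k)_{k=0}^\infty$ be generated by the ADMM with penalty parameter $\gamma$. Then $$Mx^k\to Mx^\star,\quad z^k\to z^\star\quad\text{and}\quad y^k\to y^\star,$$ where $(x^\star,z^\star,y^\star)$ is a critical point of $L_0$. Consequently, $(x^\star,z^\star)$ is a solution of $(\mathcal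 P)$. If, in particular, (B.5) or (B.6) holds, then $x^k\to x^\star$.
   Context: $\operatorname{dom} h=\{x:h(x)<+\infty\}$; $f^*(u)=\sup_x\{\langle u,x\rangle-f(x)\}$ is the Fenchel conjugate; $(\operatorname{rec} f)(y)=\sup_{x\in\operatorname{dom} f}\{f(x+y)-f(x)\}$ is the recession function. $f$ is strongly convex if $f-\frac{\alpha}{2}\|\cdot\|^2$ is convex for some $\alpha>0$; coercive if $f(x)\to+\infty$ as $\|x\|\to\infty$; supercoercive if $f(x)/\|x\|\to+\infty$ as $\|x\|\to\infty$. $\operatorname{ri}$ of a set is its relative interior (interior relative to its affine hull); $\operatorname{ran}$ and $\ker$ are range and null space; for a set-valued operator $A$, $\operatorname{ran} A=\bigcup_x A(x)$. For $\gamma\ge 0$ the augmented Lagrangian is $L_\gamma(x,z,y)=f(x)+g(z)+\langle y,Mx-z\rangle+\frac{\gamma}{2}\|Mx-z\|^2$; $L_0$ is the (unaugmented) Lagrangian. $\partial$ is the convex subdifferential: $\partial f(x)=\{u:\langle y-x,u\rangle+f(x)\le f(y)\ \forall y\}$ for $x\in\operatorname{dom} f$, empty otherwise. (For convex $g$ the Fréchet subdifferential $\widehat\partial g$, used by the paper in the definition of critical point, coincides with $\partial g$.) A triple $(x^\star,z^\star,y^\star)\in\mathbb{R}^n\times\mathbb{R}^m\times\mathbb{R}^m$ is a critical point of $L_0$ if $-M^Ty^\star\in\partial f(x^\star)$, $y^\star\in\partial g(z^\star)$ and $Mx^\star-z^\star=0$. It is a saddle point of $L_0$ if $L_0(x^\star,z^\star,y)\le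 L_0(x^\star,z^\star,y^\star)\le L_0(x,z,y^\star)$ for all $(x,z,y)\in\mathbb{R}^n\times\mathbb{R}^m\times\mathbb{R}^m$. The ADMM with penalty parameter $\gamma>0$ and initial point $(x^0,z^0,y^0)$ iterates, for $k=0,1,2,\dots$: $x^{k+1}$ is a minimizer of $x\mapsto L_\gamma(x,z^k,y^k)$ over $\mathbb{R}^n$; $z^{k+1}$ is a minimizer of $z\mapsto L_\gamma(x^{k+1},z,y^k)$ over $\mathbb{R}^m$; $y^{k+1}=y^k+\gamma(Mx^{k+1}-z^{k+1})$.
   Formalization: In the ADMM steps the summand of L_γ constant in the updated variable (g(z^k), resp. f(x^{k+1})) is dropped: if z^0 lies outside dom g, L_γ(·,z^0,y^0) is identically +∞, every point is a minimizer, and the claim as stated fails. *)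

(* Defs.v *)
From mathcomp Require Import all_boot all_order all_algebra.
From mathcomp Require Import all_classical all_reals all_analysis.

Set Implicit Arguments.
Unset Strict Implicit.
Unset Printing Implicit Defensive.

Import Order.TTheory GRing.Theory Num.Theory.
Import numFieldNormedType.Exports.

Local Open Scope classical_set_scope.
Local Open Scope ring_scope.
Local Open Scope ereal_scope.

(* The normed structure that the library puts on matrices is the max norm, so
   the Euclidean structure of R^n is defined here; the topology (entrywise
   convergence) is the same, and the library's one is used. *)
Definition dot (R : realType) (n : nat) (u v : 'cV[R]_n) : R :=
  (\sum_(i < n) u i ord0 * v i ord0)%R.

Definition enorm (R : realType) (n : nat) (u : 'cV[R]_n) : R :=
  Num.sqrt (dot u u).

Definition edom (R : realType) (n : nat) (h : 'cV[R]_n -> \bar R) :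
  set 'cV[R]_n := [set x | h x < +oo].

(* Values in ]-oo, +oo] and not identically +oo. *)
Definition proper_fun (R : realType) (n : nat) (h : 'cV[R]_n -> \bar R) : Prop :=
  (forall x, -oo < h x) /\ edom h !=set0.

Definition convex_efun (R : realType) (n : nat) (h : 'cV[R]_n -> \bar R) : Prop :=
  forall (x y : 'cV[R]_n) (t : R), (0 < t < 1)%R ->
    h (t *: x + (1 - t) *: y)%R <= t%:E * h x + (1 - t)%:E * h y.

Definition strongly_convex (R : realType) (n : nat) (h : 'cV[R]_n -> \bar R) :
  Prop :=
  exists2 a : R, (0 < a)%R &
    convex_efun (fun x => h x - (a / 2 * enorm x ^+ 2)%:E).

Definition coercive (R : realType) (n : nat) (h : 'cV[R]_n -> \bar R) : Prop :=
  forall A : R, exists r : R, forall x, (r < enorm x)%R -> A%:E < h x.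

Definition fenchel_conj (R : realType) (n : nat) (h : 'cV[R]_n -> \bar R)
  (u : 'cV[R]_n) : \bar R :=
  ereal_sup [set (dot u x)%:E - h x | x in [set: 'cV[R]_n]].

Definition recession (R : realType) (n : nat) (h : 'cV[R]_n -> \bar R)
  (y : 'cV[R]_n) : \bar R :=
  ereal_sup [set h (x + y)%R - h x | x in edom h].

Definition subdiff (R : realType) (n : nat) (h : 'cV[R]_n -> \bar R)
  (x : 'cV[R]_n) : set 'cV[R]_n :=
  [set u | edom h x /\ forall y, (dot (y - x)%R u)%:E + h x <= h y].

Definition set_ran (S T : Type) (A : S -> set T) : set T :=
  \bigcup_(x in [set: S]) A x.

Definition affine_set (R : realType) (n : nat) (A : set 'cV[R]_n) : Prop :=
  forall (x y : 'cV[R]_n) (t : R), A x -> A y -> A (t *: x + (1 - t) *: y)%R.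

Definition affine_hull (R : realType) (n : nat) (C : set 'cV[R]_n) :
  set 'cV[R]_n := smallest (@affine_set R n) C.

Definition rel_interior (R : realType) (n : nat) (C : set 'cV[R]_n) :
  set 'cV[R]_n :=
  [set x | C x /\ \forall y \near x, affine_hull C y -> C y].

Definition set_sub (R : realType) (n : nat) (A B : set 'cV[R]_n) :
  set 'cV[R]_n := [set (u - v)%R | u in A & v in B].

Definition mx_range (R : realType) (p q : nat) (A : 'M[R]_(p, q)) :
  set 'cV[R]_p := [set A *m x | x in [set: 'cV[R]_q]]%R.

Definition mx_ker (R : realType) (p q : nat) (A : 'M[R]_(p, q)) :
  set 'cV[R]_q := [set x | A *m x = 0]%R.

Definition coupling (R : realType) (m n : nat) (M : 'M[R]_(m, n)) (gamma : R)
  (x : 'cV[R]_n) (z y : 'cV[R]_m) : R :=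
  (dot y (M *m x - z) + gamma / 2 * enorm (M *m x - z) ^+ 2)%R.

Definition aug_lagrangian (R : realType) (m n : nat) (M : 'M[R]_(m, n))
  (f : 'cV[R]_n -> \bar R) (g : 'cV[R]_m -> \bar R) (gamma : R)
  (x : 'cV[R]_n) (z y : 'cV[R]_m) : \bar R :=
  f x + g z + (coupling M gamma x z y)%:E.

Definition critical_point (R : realType) (m n : nat) (M : 'M[R]_(m, n))
  (f : 'cV[R]_n -> \bar R) (g : 'cV[R]_m -> \bar R)
  (xs : 'cV[R]_n) (zs ys : 'cV[R]_m) : Prop :=
  [/\ subdiff f xs (- (M^T *m ys))%R, subdiff g zs ys & (M *m xs - zs = 0)%R].

Definition saddle_point (R : realType) (m n : nat) (M : 'M[R]_(m, n))
  (f : 'cV[R]_n -> \bar R) (g : 'cV[R]_m -> \bar R)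
  (xs : 'cV[R]_n) (zs ys : 'cV[R]_m) : Prop :=
  let L0 := aug_lagrangian M f g 0%R in
  forall (x : 'cV[R]_n) (z y : 'cV[R]_m),
    L0 xs zs y <= L0 xs zs ys /\ L0 xs zs ys <= L0 x z ys.

Definition optimal_solution (R : realType) (m n : nat) (M : 'M[R]_(m, n))
  (f : 'cV[R]_n -> \bar R) (g : 'cV[R]_m -> \bar R)
  (xs : 'cV[R]_n) (zs : 'cV[R]_m) : Prop :=
  (M *m xs = zs)%R /\
  forall (x : 'cV[R]_n) (z : 'cV[R]_m),
    (M *m x = z)%R -> f xs + g zs <= f x + g z.

Definition minimizer (T : Type) (R : realType) (h : T -> \bar R) (x : T) : Prop :=
  forall x', h x <= h x'.

(* In each update the summand of the augmented Lagrangian that does not depend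
   on the updated variable is omitted. This changes nothing when that summand
   is finite (see the two lemmas below). But z 0 need not lie in dom g, and then
   the augmented Lagrangian is identically +oo in x: keeping the summand g (z 0)
   would make every point a "minimizer", and the updates would be arbitrary. *)
Definition admm (R : realType) (m n : nat) (M : 'M[R]_(m, n))
  (f : 'cV[R]_n -> \bar R) (g : 'cV[R]_m -> \bar R) (gamma : R)
  (x : nat -> 'cV[R]_n) (z y : nat -> 'cV[R]_m) : Prop :=
  forall k : nat,
    [/\ minimizer (fun x' => f x' + (coupling M gamma x' (z k) (y k))%:E)
          (x k.+1),
        minimizer (fun z' => g z' + (coupling M gamma (x k.+1) z' (y k))%:E)
          (z k.+1)
      & (y k.+1 = y k + gamma *: (M *m x k.+1 - z k.+1))%R].

Lemma minimizer_aug_lagrangian_x (R : realType) (m n : nat) (M : 'M[R]_(m, n))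
  (f : 'cV[R]_n -> \bar R) (g : 'cV[R]_m -> \bar R) (gamma : R)
  (x : 'cV[R]_n) (z y : 'cV[R]_m) : g z \is a fin_num ->
  minimizer (fun x' => aug_lagrangian M f g gamma x' z y) x <->
  minimizer (fun x' => f x' + (coupling M gamma x' z y)%:E) x.
Proof.
move=> gz; rewrite /minimizer /aug_lagrangian.
by split=> H x'; move: (H x'); rewrite ![f _ + g z + _]addeAC leeD2rE.
Qed.

Lemma minimizer_aug_lagrangian_z (R : realType) (m n : nat) (M : 'M[R]_(m, n))
  (f : 'cV[R]_n -> \bar R) (g : 'cV[R]_m -> \bar R) (gamma : R)
  (x : 'cV[R]_n) (z y : 'cV[R]_m) : f x \is a fin_num ->
  minimizer (fun z' => aug_lagrangian M f g gamma x z' y) z <->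
  minimizer (fun z' => g z' + (coupling M gamma x z' y)%:E) z.
Proof.
move=> fx; rewrite /minimizer /aug_lagrangian.
by split=> H z'; move: (H z'); rewrite -![f x + g _ + _]addeA leeD2lE.
Qed.

(* Main.v *)
(* Bounded sequences are made to converge along one fixed ultrafilter finer than
   [\oo], so that no subsequence is ever extracted.
   A critical point exists: a saddle point is one, and under (A.2) the
   multipliers of the quadratically penalized problems stay bounded.
   Each of (B.1)-(B.6) implies that if f does not increase along a direction
   d of ker M, then f is constant along d. For (B.1) and (B.2), d is first shown
   to be orthogonal to ran (subdiff f); this gives f (x - d) <= f x through the
   proximal points of x - d. The same property makes the set of pairs
   (M x, u) with M^T u in subdiff f x closed: each x can be replaced by the
   point of least norm with the same M x and no larger f x, and such points
   cannot escape to infinity.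
   Finally |y - ys|^2 + gamma^2 |z - zs|^2 decreases along the ADMM for every
   critical point (xs, zs, ys), hence the iterates (z, y) are bounded and their
   increments vanish. The limit along the ultrafilter is part of a critical
   point by closedness, and the Lyapunov function of that critical point tends to
   0. *)
Require Import Defs.
From mathcomp Require Import all_boot all_order all_algebra.
From mathcomp Require Import all_classical all_reals all_analysis.
From mathcomp Require Import ring lra.

Set Implicit Arguments.
Unset Strict Implicit.
Unset Printing Implicit Defensive.

Import Order.TTheory GRing.Theory Num.Theory.
Import numFieldNormedType.Exports.

Local Open Scope classical_set_scope.
Local Open Scope ring_scope.

Local Notation nsq u := (dot u u).

Local Ltac vec_ring := apply/matrixP => ? ?; rewrite !mxE; ring.

(** * Euclidean inner product *)

Section dot_theory.
Context {R : realType}.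

Lemma dotC n (u v : 'cV[R]_n) : dot u v = dot v u.
Proof. by apply: eq_bigr => i _; rewrite mulrC. Qed.

Lemma dotDl n (u v w : 'cV[R]_n) : dot (u + v) w = dot u w + dot v w.
Proof. by rewrite -big_split; apply: eq_bigr => i _; rewrite mxE mulrDl. Qed.

Lemma dotZl n a (u v : 'cV[R]_n) : dot (a *: u) v = a * dot u v.
Proof. by rewrite big_distrr; apply: eq_bigr => i _; rewrite /= mxE mulrA. Qed.

Lemma dotDr n (u v w : 'cV[R]_n) : dot u (v + w) = dot u v + dot u w.
Proof. by rewrite dotC dotDl !(dotC u). Qed.

Lemma dotZr n a (u v : 'cV[R]_n) : dot u (a *: v) = a * dot u v.
Proof. by rewrite dotC dotZl dotC. Qed.

Lemma dotNl n (u v : 'cV[R]_n) : dot (- u) v = - dot u v.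
Proof. by rewrite -scaleN1r dotZl mulN1r. Qed.

Lemma dotNr n (u v : 'cV[R]_n) : dot u (- v) = - dot u v.
Proof. by rewrite dotC dotNl dotC. Qed.

Lemma dot0l n (u : 'cV[R]_n) : dot 0 u = 0.
Proof. by rewrite -(scale0r 0) dotZl mul0r. Qed.

Lemma dot0r n (u : 'cV[R]_n) : dot u 0 = 0.
Proof. by rewrite dotC dot0l. Qed.

Definition dotE := (dotDl, dotDr, dotNl, dotNr, dotZl, dotZr).

Lemma dot_trmxl m n (A : 'M[R]_(m, n)) u x : dot (A^T *m u) x = dot u (A *m x).
Proof.
rewrite /dot; under eq_bigr do rewrite mxE mulr_suml.
rewrite exchange_big; apply: eq_bigr => i _ /=; rewrite mxE mulr_sumr.
by apply: eq_bigr => j _; rewrite mxE mulrA (mulrC (A i j)).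
Qed.

Lemma dot_trmxr m n (A : 'M[R]_(m, n)) x u : dot x (A^T *m u) = dot (A *m x) u.
Proof. by rewrite dotC dot_trmxl dotC. Qed.

Lemma nsq_ge0 n (u : 'cV[R]_n) : 0 <= nsq u.
Proof. by apply: sumr_ge0 => i _; rewrite -expr2 sqr_ge0. Qed.

Lemma coord_le_nsq n (u : 'cV[R]_n) i j : u i j ^+ 2 <= nsq u.
Proof.
rewrite /dot (bigD1 i) //= (ord1 j) -expr2 lerDl.
by apply: sumr_ge0 => k _; rewrite -expr2 sqr_ge0.
Qed.

Lemma nsq_eq0 n (u : 'cV[R]_n) : nsq u <= 0 -> u = 0.
Proof.
move=> u0; apply/matrixP => i j; rewrite mxE; apply/eqP.
by rewrite -sqrf_eq0 -[_ == _]orbF eq_le sqr_ge0 (le_trans (coord_le_nsq u i j)).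
Qed.

Lemma enorm_ge0 n (u : 'cV[R]_n) : 0 <= enorm u.
Proof. exact: sqrtr_ge0. Qed.

Lemma enorm_sqr n (u : 'cV[R]_n) : enorm u ^+ 2 = nsq u.
Proof. by rewrite sqr_sqrtr ?nsq_ge0. Qed.

Lemma nsqB_ge n (u v : 'cV[R]_n) : nsq u <= 2 * nsq (u - v) + 2 * nsq v.
Proof.
have := nsq_ge0 (u - 2 *: v); rewrite !dotE (dotC v u); lra.
Qed.

End dot_theory.

(** * Limits along filters and ultrafilters *)

Section limits.
Context {R : realType}.

Lemma cvg_coord T (F : set_system T) (FF : Filter F) n
  (u : T -> 'cV[R]_n) (a : 'cV[R]_n) i :
  u @ F --> a -> (fun k => u k i ord0) @ F --> a i ord0.
Proof.
by move=> ua; exact: (cvg_comp _ _ ua (@coord_continuous _ _ _ i ord0 a)).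
Qed.

Lemma cvg_dot T (F : set_system T) (FF : Filter F) n
  (u v : T -> 'cV[R]_n) (a b : 'cV[R]_n) :
  u @ F --> a -> v @ F --> b -> (fun k => dot (u k) (v k)) @ F --> dot a b.
Proof.
move=> ua vb; apply: cvg_big => [|i _]; first exact: add_continuous.
by apply: cvgM; exact: cvg_coord.
Qed.

Lemma coord_cvg T (F : set_system T) (FF : Filter F) n
  (u : T -> 'cV[R]_n) (a : 'cV[R]_n) :
  (forall i, (fun k => u k i ord0) @ F --> a i ord0) -> u @ F --> a.
Proof.
move=> ua; apply/cvg_ballP => e e0.
have H i : \forall k \near F, ball (a i ord0) e (u k i ord0).
  by move: e e0; apply/cvg_ballP.
by apply: filterS (filter_forall _ H) => k Hk; split=> // i j; rewrite (ord1 j).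
Qed.

Lemma cvg_mulmx T (F : set_system T) (FF : Filter F) m n (A : 'M[R]_(m, n))
  (u : T -> 'cV[R]_n) (a : 'cV[R]_n) :
  u @ F --> a -> (fun k => A *m u k) @ F --> A *m a.
Proof.
move=> ua; apply: coord_cvg => i.
have E v : (A *m v) i ord0 = dot (row i A)^T v.
  by rewrite mxE; apply: eq_bigr => j _; rewrite !mxE.
by rewrite E; under eq_fun do rewrite E; apply: cvg_dot => //; exact: cvg_cst.
Qed.

Lemma cvg_nsq0 T (F : set_system T) (FF : Filter F) n
  (u : T -> 'cV[R]_n) (a : 'cV[R]_n) :
  (fun k => nsq (u k - a)) @ F --> (0 : R) -> u @ F --> a.
Proof.
move=> u0; apply: coord_cvg => i; apply/cvgrPdist_lt => e e0.
have /cvgrPdist_lt/(_ _ (exprn_gt0 2 e0)) := u0.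
apply: filterS => k; rewrite sub0r normrN (ger0_norm (nsq_ge0 _)) => Hk.
rewrite -(ltr_pXn2r (n:=2)) ?nnegrE ?normr_ge0 ?(ltW e0)//.
rewrite real_normK ?num_real// -sqrrN opprB; apply: le_lt_trans Hk.
by have := coord_le_nsq (u k - a) i ord0; rewrite !mxE.
Qed.

(** Compactness gives a cluster point, and an ultrafilter converges to its cluster points because it
    contains every set or its complement. *)
Lemma bounded_ultra_cvgr T (U : set_system T) (UU : UltraFilter U)
  (r : T -> R) a b : (forall k, a <= r k <= b) -> exists l : R, r @ U --> l.
Proof.
move=> rab; have PU := @ultra_proper _ _ UU.
have [|l [_ cl]] := @segment_compact R a b (r @ U) _.
  by rewrite /fmap/=; apply: filterE => k /=; rewrite in_itv; exact: rab.
exists l => V lV; have [//|UV] := in_ultra_setVsetC (r @^-1` V) UU.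
by have [v [nVv /nVv]] := cl (~` V) V UV lV.
Qed.

Lemma bounded_ultra_cvg T (U : set_system T) (UU : UltraFilter U) n
  (u : T -> 'cV[R]_n) B : (forall k, nsq (u k) <= B) -> exists l : 'cV[R]_n, u @ U --> l.
Proof.
move=> uB; have PU := @ultra_proper _ _ UU.
have H i : exists l : R, (fun k => u k i ord0) @ U --> l.
  apply: (@bounded_ultra_cvgr _ _ _ _ (- (1 + B)) (1 + B)) => k.
  rewrite -ler_norml -(ler_pXn2r (n:=2)) ?nnegrE ?normr_ge0//; last first.
    by rewrite addr_ge0// (le_trans (nsq_ge0 (u k))).
  have := coord_le_nsq (u k) i ord0; rewrite real_normK ?num_real//.
  have := uB k; have := nsq_ge0 (u k); nra.
have [l Hl] := choice H; exists (\col_i l i).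
by apply: coord_cvg => i; rewrite mxE.
Qed.

Lemma nat_ultra : exists2 U : set_system nat, UltraFilter U & \oo `<=` U.
Proof. by have [U [UU oU]] := ultraFilterLemma eventually_filter; exists U. Qed.

(** The constant 2 keeps [t] below 1 even at [p = 0]; the norm of [t *: p] is [1 - 2 * t]. *)
Lemma shrink_factor n (p : 'cV[R]_n) : let t := (2 + enorm p)^-1 in
  (0 < t < 1) * (t * (2 + enorm p) = 1) * (nsq (t *: p) = (1 - 2 * t) ^+ 2).
Proof.
move=> t; have e0 := enorm_ge0 p.
have te : t * (2 + enorm p) = 1 by rewrite mulVf// gt_eqF//; lra.
have t0 : 0 < t by rewrite invr_gt0; lra.
split; last by rewrite dotZl dotZr -enorm_sqr -[X in (X - _) ^+ 2]te; ring.
by split=> //; nra.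
Qed.

(** With [t] as in [shrink_factor], both [t] and [t *: p] are bounded, hence converge. If [t] has a
    nonzero limit, [p] converges to the quotient; otherwise the norms [1 - 2 * t] tend to 1 and [d]
    is a unit direction of escape. *)
Lemma ultra_cvg_or_recede T (U : set_system T) (UU : UltraFilter U) n
  (p : T -> 'cV[R]_n) :
  (exists l : 'cV[R]_n, p @ U --> l) \/
  exists (t : T -> R) (d : 'cV[R]_n),
    [/\ forall k, 0 < t k < 1, t @ U --> (0 : R),
        (fun k => t k *: p k) @ U --> d & nsq d = 1].
Proof.
have PU := @ultra_proper _ _ UU; pose t k := (2 + enorm (p k))^-1.
have t01 k : 0 < t k < 1 by rewrite (shrink_factor (p k)).
have nt k : nsq (t k *: p k) = (1 - 2 * t k) ^+ 2 by rewrite (shrink_factor (p k)).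
have [k|l tl] := @bounded_ultra_cvgr _ _ UU t 0 1.
  by have := t01 k; lra.
have [k|d pd] := @bounded_ultra_cvg _ _ UU _ (fun k => t k *: p k) 1.
  by rewrite nt; have := t01 k; nra.
have [l0|l0] := eqVneq l 0.
  right; exists t, d; split=> //; first by rewrite -l0.
  have tl1 : (fun k => 1 - 2 * t k) @ U --> 1 - 2 * l.
    by apply: cvgB; [exact: cvg_cst|apply: cvgM => //; exact: cvg_cst].
  have H : (fun k => nsq (t k *: p k)) @ U --> (1 : R).
    have -> : (1 : R) = (1 - 2 * l) * (1 - 2 * l) by rewrite l0; ring.
    by under eq_fun do rewrite nt expr2; exact: cvgM.
  exact: (cvg_unique (@norm_hausdorff _ _) (cvg_dot _ pd pd) H).
left; exists (l^-1 *: d).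
have -> : p = fun k => (t k)^-1 *: (t k *: p k).
  apply/funext => k; rewrite scalerA mulVf ?scale1r// gt_eqF//.
  by have /andP[] := t01 k.
by apply: cvgZ => //; exact: cvgV.
Qed.

Lemma cvg0_of_mulS_le (r : nat -> R) K :
  (forall k, 0 <= r k) -> (forall k, k.+1%:R * r k <= K) -> r @ \oo --> 0.
Proof.
move=> r0 rK; apply: (@squeeze_cvgr _ _ _ _ (fun=> 0) (fun k => K * harmonic k)).
- apply: nearW => k; rewrite r0 /=.
  by rewrite /harmonic ler_pdivlMr ?ltr0Sn// mulrC.
- exact: cvg_cst.
- by rewrite -(mulr0 K); apply: cvgM; [exact: cvg_cst|exact: cvg_harmonic].
Qed.

Lemma mulS_le_le0 (r K : R) : (forall k, k.+1%:R * r <= K) -> r <= 0.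
Proof.
move=> rK; rewrite leNgt; apply/negP => r0.
have : r = 0.
  apply: (cvg_unique (@norm_hausdorff _ _) (cvg_cst (F := \oo) r)).
  by apply: (@cvg0_of_mulS_le (fun=> r) K) => // _; exact: ltW.
by move/eqP; rewrite gt_eqF.
Qed.

End limits.

(** * Closed convex functions *)

Section convex_functions.
Context {R : realType}.

Lemma edom_EFin n (f : 'cV[R]_n -> \bar R) x :
  proper_fun f -> edom f x -> exists a, f x = a%:E.
Proof.
move=> [fNy _]; rewrite /edom /=; have := fNy x.
by case: (f x) => // a; exists a.
Qed.

(** Extended values are handled below through real upper bounds [f x <= b%:E], that is, through
    points of the epigraph. *)
Lemma le_EFin_eq n (f : 'cV[R]_n -> \bar R) x b :
  proper_fun f -> (f x <= b%:E)%E -> exists2 a, f x = a%:E & a <= b.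
Proof.
move=> pf fb; have [|a fa] := @edom_EFin _ f x pf.
  by rewrite /edom /= (le_lt_trans fb) ?ltry.
by exists a => //; rewrite fa lee_fin in fb.
Qed.

Lemma convex_le n (f : 'cV[R]_n -> \bar R) x y a b t :
  convex_efun f -> 0 < t < 1 -> (f x <= a%:E)%E -> (f y <= b%:E)%E ->
  (f (t *: x + (1 - t) *: y)%R <= (t * a + (1 - t) * b)%:E)%E.
Proof.
move=> cf t01 fa fb; apply: le_trans (cf x y t t01) _.
have [t0 t1] := andP t01; rewrite (EFinD (t * a)) !EFinM; apply: leeD.
  by apply: lee_wpmul2l => //; rewrite lee_fin ltW.
by apply: lee_wpmul2l => //; rewrite lee_fin subr_ge0 ltW.
Qed.

(** The epigraph of a lower semicontinuous function is closed; the heights [r k] may vary. *)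
Lemma lsc_cvg_le n (f : 'cV[R]_n -> \bar R) T (F : set_system T)
  (PF : ProperFilter F) (u : T -> 'cV[R]_n) (r : T -> R) (x : 'cV[R]_n) (a : R) :
  lower_semicontinuous f -> u @ F --> x -> r @ F --> a ->
  (\forall k \near F, (f (u k) <= (r k)%:E)%E) -> (f x <= a%:E)%E.
Proof.
move=> lf ux ra fr; apply/lee_addgt0Pr => e e0; rewrite leNgt; apply/negP => ltf.
have [V xV Vf] := lf x _ ltf.
have : \forall k \near F, False; last by move/filter_ex => -[].
have /cvgrPdist_lt/(_ _ e0) := ra; move: fr (ux _ xV); apply: filterS3.
move=> k fk /Vf fV; rewrite ltr_distlC => /andP[_ rk].
by have := lt_le_trans fV fk; rewrite lte_fin; lra.
Qed.

Lemma subdiffP n (f : 'cV[R]_n -> \bar R) x u : proper_fun f ->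
  subdiff f x u <-> exists2 a, f x = a%:E &
    forall w b, (f w <= b%:E)%E -> a + dot (w - x) u <= b.
Proof.
move=> pf; split=> [[dx fu]|[a fx fu]].
  have [a fx] := edom_EFin pf dx; exists a => // w b fb.
  by have := le_trans (fu w) fb; rewrite fx lee_fin addrC.
split=> [|w]; first by rewrite /edom /= fx ltry.
rewrite fx; case E : (f w) => [b| |]; rewrite ?leey//.
  by rewrite lee_fin addrC; apply: fu; rewrite E.
by have := pf.1 w; rewrite E.
Qed.

(** The subgradient inequality at a fixed [w] is an upper bound on [f (x k)], which passes to the
    limit; a [w] in the domain makes [f a] finite. *)
Lemma subdiff_closed n (f : 'cV[R]_n -> \bar R) T (F : set_system T)
  (PF : ProperFilter F) (x u : T -> 'cV[R]_n) (a v : 'cV[R]_n) :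
  proper_fun f -> lower_semicontinuous f ->
  x @ F --> a -> u @ F --> v -> (forall k, subdiff f (x k) (u k)) ->
  subdiff f a v.
Proof.
move=> pf lf xa uv fu.
have H w b : (f w <= b%:E)%E -> (f a <= (b - dot (w - a) v)%:E)%E.
  move=> fb; apply: (@lsc_cvg_le _ f T F _ x (fun k => b - dot (w - x k) (u k)) a _ lf xa).
    apply: cvgB; first exact: cvg_cst.
    by apply: cvg_dot => //; apply: cvgB => //; exact: cvg_cst.
  apply: nearW => k; have /(subdiffP _ _ pf)[c -> /(_ _ _ fb)] := fu k.
  by rewrite lee_fin; lra.
have [_ [w0 dw0]] := pf; have [b0 fw0] := edom_EFin pf dw0.
have [|c fc _] := le_EFin_eq pf (H w0 b0 _); first by rewrite fw0.
apply/subdiffP => //; exists c => // w b /H; rewrite fc lee_fin; lra.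
Qed.

(** Compare [x] with [t *: w + (1 - t) *: x], divide by [t] and let [t] tend to 0. An exact second
    order expansion of [q] along segments stands for its gradient [v] at [x]. *)
Lemma minimizer_subdiff n (f : 'cV[R]_n -> \bar R) (q : 'cV[R]_n -> R) x v :
  proper_fun f -> convex_efun f ->
  minimizer (fun w => f w + (q w)%:E)%E x ->
  (forall w, exists c, forall t, 0 < t < 1 ->
     q (t *: w + (1 - t) *: x) = q x + t * dot (w - x) v + t ^+ 2 * c) ->
  subdiff f x (- v).
Proof.
move=> pf cf minx qE; have [_ [w0 dw0]] := pf.
have [b0 fw0] := edom_EFin pf dw0.
have [a fx] : exists a, f x = a%:E.
  apply: edom_EFin => //; rewrite /edom /=; have := minx w0; rewrite fw0.
  by case: (f x) => // r; rewrite ltry.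
apply/subdiffP => //; exists a => // w b fb; rewrite dotNr.
have [c qc] := qE w; rewrite -subr_ge0; set l := dot _ _; set d := _ - _.
have H t : 0 < t < 1 -> 0 <= d + t * c.
  move=> t01; have [t0 t1] := andP t01.
  rewrite -(pmulr_rge0 _ t0).
  have fxa : (f x <= a%:E)%E by rewrite fx.
  have [e fe le] := le_EFin_eq pf (convex_le cf t01 fb fxa).
  have := minx (t *: w + (1 - t) *: x); rewrite fe fx qc// lee_fin -/l.
  by rewrite /d; nra.
rewrite leNgt; apply/negP => d0.
have c0 : 0 < c by have := H (1/2); lra.
(* If [d < 0], then [d + t * c <= d / 2 < 0] at this [t]; the cap [1 / 2] keeps [t] below 1. *)
have := H (Num.min (1 / 2) (- d / (2 * c))); rewrite minEle.
have dc : 0 < - d / (2 * c) by rewrite divr_gt0 ?oppr_gt0 ?mulr_gt0.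
have E : - d / (2 * c) * c = - d / 2 by field; rewrite gt_eqF.
case: ifPn => [h|]; first by have : 1/2 * c <= - d / (2 * c) * c; nra.
rewrite -ltNge E => h; have /[swap]/[apply] : 0 < - d / (2 * c) < 1 by lra.
by lra.
Qed.

(** The direct method without a topology on [T]: the last hypothesis combines compactness of
    sublevel sets with lower semicontinuity, and is applied to a minimizing sequence. *)
Lemma minimizer_exists T (F : T -> \bar R) :
  (forall t, -oo < F t)%E -> (exists t, F t < +oo)%E ->
  (forall (s : nat -> T) B, (forall k, F (s k) <= B%:E)%E ->
     exists t, forall l : R, (\forall k \near \oo, F (s k) <= l%:E)%E ->
       (F t <= l%:E)%E) ->
  exists t, minimizer F t.
Proof.
move=> Fy [t0 Ft0] HF.
have [|u Fu uinf] := @ereal_inf_seq R (range F).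
  by apply/set0P; exists (F t0), t0.
have near_inf (l : R) : (ereal_inf (range F) < l%:E)%E ->
    \forall k \near \oo, (u k <= l%:E)%E.
  move=> infl; have [K _ HK] := uinf _ (open_ereal_lt' infl).
  by exists K => // k Kk; apply/ltW; exact: HK.
have [B FtB] : exists B, (F t0 < B%:E)%E.
  case: (F t0) Ft0 => // [r _|_]; last by exists 0; exact: ltNyr.
  by exists (r + 1); rewrite lte_fin; lra.
have infB : (ereal_inf (range F) < B%:E)%E.
  by apply: le_lt_trans FtB; apply: ereal_inf_lbound; exists t0.
have [N _ HN] := near_inf _ infB.
(* The shift by [N] puts all values of the sequence, not only almost all, below [B]. *)
have HN2 k : exists t, F t = u (k + N)%N by have [t _ <-] := Fu (k + N)%N; exists t.
have [s sE] := choice HN2.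
have [|t Ht] := HF s B; first by move=> k; rewrite sE; apply: HN; rewrite /= leq_addl.
exists t => t'; apply/lee_addgt0Pr => e e0.
have tinf : (ereal_inf (range F) <= F t')%E by apply: ereal_inf_lbound; exists t'.
case E : (F t') tinf => [r| |] tinf; last 2 first.
- by rewrite addye// leey.
- by have := Fy t'; rewrite E.
apply: Ht; have [|K _ HK] := near_inf (r + e).
  by rewrite (le_lt_trans tinf)// lte_fin; lra.
by exists K => // k /= Kk; rewrite sE; apply: HK; rewrite /= (leq_trans Kk) ?leq_addr.
Qed.

End convex_functions.

(** * Lower bounds, proximal points and relative interiors *)

Section closed_convex_functions.
Context {R : realType}.

Lemma lee_addEFin (a : \bar R) (q l : R) : (a + q%:E <= l%:E)%E = (a <= (l - q)%:E)%E.
Proof. by rewrite EFinB leeBrDr. Qed.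

(** A weak affine minorant. If no [C] worked, points with values below
    [- k%:R * (2 + enorm (w - x0))], shrunk towards [x0] as in [shrink_factor], would stay bounded
    with values at most [|a0| - k], and [f] would be -oo at a limit point. *)
Lemma convex_lower_bound n (f : 'cV[R]_n -> \bar R) x0 a0 :
  proper_fun f -> lower_semicontinuous f -> convex_efun f -> f x0 = a0%:E ->
  exists2 C, 0 <= C &
    forall w b, (f w <= b%:E)%E -> - C * (2 + enorm (w - x0)) <= b.
Proof.
move=> pf lf cf fx0; apply: contrapT => nC.
have H (k : nat) : exists wb : 'cV[R]_n * R,
    (f wb.1 <= wb.2%:E)%E /\ wb.2 < - k%:R * (2 + enorm (wb.1 - x0)).
  apply: contrapT => nk; apply: nC; exists k%:R => // w b fw.
  by rewrite leNgt; apply/negP => bk; apply: nk; exists (w, b).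
have [wb wbP] := choice H.
pose e k := enorm ((wb k).1 - x0); pose t k := (2 + e k)^-1.
have e0 k : 0 <= e k by exact: enorm_ge0.
have te k : t k * (2 + e k) = 1 by rewrite (shrink_factor ((wb k).1 - x0)).
have t1 k : 0 < t k < 1 by rewrite (shrink_factor ((wb k).1 - x0)).
pose s k := t k *: (wb k).1 + (1 - t k) *: x0.
have sx0 k : s k - x0 = t k *: ((wb k).1 - x0).
  by rewrite /s; vec_ring.
have fs k : (f (s k) <= (`|a0| - k%:R)%:E)%E.
  have fa0 : (f x0 <= a0%:E)%E by rewrite fx0.
  apply: le_trans (convex_le cf (t1 k) (wbP k).1 fa0) _.
  have := (wbP k).2; rewrite lee_fin -/(e k) => wk.
  have : t k * (wb k).2 <= t k * (- k%:R * (2 + e k)) by rewrite ler_wpM2l ?ltW//; have /andP[] := t1 k.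
  rewrite mulrCA te mulr1; have := ler_norm a0; have := normr_ge0 a0.
  by have := t1 k; set A := `|a0|; nra.
have [U UU oU] := nat_ultra; have PU := @ultra_proper _ _ UU.
have [k|w sw] := @bounded_ultra_cvg _ _ _ UU _ s (2 * 1 + 2 * nsq x0).
  apply: le_trans (nsqB_ge (s k) x0) _; rewrite lerD2r ler_wpM2l// sx0.
  by rewrite (shrink_factor ((wb k).1 - x0)) -/(e k) -/(t k); have := t1 k; nra.
have fw N : (f w <= (- N)%:E)%E.
  apply: (@lsc_cvg_le _ _ _ _ _ _ s (fun=> - N) w (- N) lf sw); first exact: cvg_cst.
  apply: oU; apply: filterS (nbhs_infty_ger (`|a0| + N)) => k h.
  by apply: le_trans (fs k) _; rewrite lee_fin; lra.
have [a fa _] := le_EFin_eq pf (fw 0).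
by have := fw (1 - a); rewrite fa lee_fin; lra.
Qed.

(** The linear term is absorbed by [C * r <= c / 2 * r ^+ 2 + C ^+ 2 / (2 * c)], and [nsqB_ge] moves
    the centre from [x0] to [p]. *)
Lemma convex_quad_lower_bound n (f : 'cV[R]_n -> \bar R) c p :
  proper_fun f -> lower_semicontinuous f -> convex_efun f -> 0 < c ->
  exists C, forall w b, (f w <= b%:E)%E -> - C - c * nsq (w - p) <= b.
Proof.
move=> pf lf cf c0; have [_ [x0 dx0]] := pf; have [a0 fx0] := edom_EFin pf dx0.
have [C C0 HC] := convex_lower_bound pf lf cf fx0.
exists (2 * C + C ^+ 2 / (2 * c) + c * nsq (p - x0)) => w b /HC; apply: le_trans.
have := nsqB_ge (w - x0) (p - x0).
have -> : w - x0 - (p - x0) = w - p by vec_ring.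
rewrite -(enorm_sqr (w - x0)).
set r := enorm (w - x0); set N := nsq (w - p) => rN.
have : 0 <= (c * r - C) ^+ 2 / (2 * c) by rewrite divr_ge0 ?sqr_ge0//; lra.
have -> : (c * r - C) ^+ 2 / (2 * c) = c / 2 * r ^+ 2 - C * r + C ^+ 2 / (2 * c).
  by field; rewrite gt_eqF.
by move: rN; set D := C ^+ 2 / _; set X := nsq _; nra.
Qed.

Lemma prox_exists n (f : 'cV[R]_n -> \bar R) c p :
  proper_fun f -> lower_semicontinuous f -> convex_efun f -> 0 < c ->
  exists y, subdiff f y (- ((2 * c) *: (y - p))).
Proof.
move=> pf lf cf c0.
have [|||y ymin] := @minimizer_exists R _ (fun w => f w + (c * nsq (w - p))%:E)%E.
- by move=> w; rewrite ltNye_eq; have := pf.1 w; case: (f w).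
- have [_ [x0 dx0]] := pf; exists x0; have [a ->] := edom_EFin pf dx0.
  by rewrite -EFinD ltry.
- move=> s B sB; have [U UU oU] := nat_ultra; have PU := @ultra_proper _ _ UU.
  (* A minorant with [c / 2] against the penalty [c] leaves [c / 2] to bound the sequence. *)
  have [C HC] := convex_quad_lower_bound p pf lf cf (divr_gt0 c0 (ltr0n _ 2)).
  have [k|t st] := @bounded_ultra_cvg R _ _ UU _ s (2 * (2 * (B + C) / c) + 2 * nsq p).
    apply: le_trans (nsqB_ge (s k) p) _; rewrite lerD2r ler_wpM2l// ler_pdivlMr//.
    have := sB k; rewrite lee_addEFin => /HC.
    by set N := nsq _; lra.
  exists t => l sl; rewrite lee_addEFin.
  apply: (@lsc_cvg_le _ _ _ _ _ _ s (fun k => l - c * nsq (s k - p)) _ _ lf st).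
    apply: cvgB; first exact: cvg_cst.
    apply: cvgM; first exact: cvg_cst.
    by apply: cvg_dot; apply: cvgB st (cvg_cst p).
  by apply: filterS (oU _ sl) => k; rewrite lee_addEFin.
exists y; apply: minimizer_subdiff ymin _ => // w; exists (c * nsq (w - y)) => t _.
have -> : t *: w + (1 - t) *: y - p = (y - p) + t *: (w - y).
  by vec_ring.
by move: (y - p) (w - y) => e d; rewrite !dotE (dotC e d); ring.
Qed.

(* The prox points [y] of [x - d] with parameter [1 / (2 (k + 1))] satisfy
   [f y + 2 (k + 1) |y - (x - d)|^2 <= f x], hence converge to [x - d]. *)
Lemma le_subr_subdiff_ge0 n (f : 'cV[R]_n -> \bar R) d :
  proper_fun f -> lower_semicontinuous f -> convex_efun f ->
  (forall v u, subdiff f v u -> 0 <= dot d u) ->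
  forall x b, (f x <= b%:E)%E -> (f (x - d)%R <= b%:E)%E.
Proof.
move=> pf lf cf fd x b fx; pose p := x - d.
have H (k : nat) : exists y, subdiff f y (- ((2 * k.+1%:R) *: (y - p))).
  exact: prox_exists.
have [y yP] := choice H.
have fy k : (f (y k) <= (b - 2 * k.+1%:R * nsq (y k - p))%:E)%E.
  have du := fd _ _ (yP k); have /(subdiffP _ _ pf)[a -> /(_ _ _ fx)] := yP k.
  (* In the product of [x - y k] with the subgradient, the part coming from [d] is nonnegative by
     [fd] and is dropped. *)
  rewrite lee_fin; have -> : x - y k = d - (y k - p) by rewrite /p; vec_ring.
  by rewrite dotDl dotNl !(dotNr, dotZr) in du *; lra.
have [C HC] := convex_quad_lower_bound p pf lf cf ltr01.
have yp : y @ \oo --> p.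
  apply: cvg_nsq0; apply: (@cvg0_of_mulS_le _ _ (b + C)) => k; first exact: nsq_ge0.
  have := HC _ _ (fy k); have := nsq_ge0 (y k - p); have := ler0n R k.
  by rewrite -natr1; set N := nsq _; nra.
apply: (@lsc_cvg_le _ _ _ _ _ _ y (fun=> b) _ _ lf yp); first exact: cvg_cst.
apply: nearW => k; apply: le_trans (fy k) _; rewrite lee_fin.
by have := nsq_ge0 (y k - p); have := ler0n R k.+1; nra.
Qed.

(** [p + s *: (p - w)] is an affine combination of [p] and [w], so it stays in the affine hull, and
    it tends to [p] as [s] decreases to 0. *)
Lemma rel_interior_extend n (C : set 'cV[R]_n) p w :
  rel_interior C p -> C w -> exists2 e, 0 < e & C (p + e *: (p - w)).
Proof.
move=> [Cp nC] Cw.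
have lp : (fun s : R => p + s *: (p - w)) @ 0^'+ --> p.
  rewrite -[X in _ --> X]addr0 -(scale0r (p - w)).
  apply: cvgD; first exact: cvg_cst.
  by apply: cvgZ; [apply: cvg_at_right_filter; exact: cvg_id|exact: cvg_cst].
have [s [s0 +]] := filter_ex (filterI (nbhs_right_gt (0 : R)) (lp _ nC)).
move=> Cs; exists s => //; apply: Cs => A [aA CA].
have -> : p + s *: (p - w) = (1 + s) *: p + (1 - (1 + s)) *: w.
  by vec_ring.
by apply: aA; exact: CA.
Qed.

(** In terms of the recession function: a kernel direction [d] with value at most 0 has [- d] of the
    same kind, so that [f (x + d) = f x]. See [recession_le0P]. *)
Definition kernel_lineality m n (M : 'M[R]_(m, n)) (f : 'cV[R]_n -> \bar R) :=
  forall d, M *m d = 0 ->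
    (forall x b, (f x <= b%:E)%E -> (f (x + d)%R <= b%:E)%E) ->
    (forall x b, (f x <= b%:E)%E -> (f (x - d)%R <= b%:E)%E).

(** [nsq] is minimized over a closed set, encoded by the value +oo outside it. *)
Lemma min_norm_exists m n (M : 'M[R]_(m, n)) (f : 'cV[R]_n -> \bar R) x0 c :
  lower_semicontinuous f -> (f x0 <= c%:E)%E ->
  exists x, [/\ M *m x = M *m x0, (f x <= c%:E)%E &
    forall w, M *m w = M *m x0 -> (f w <= c%:E)%E -> nsq x <= nsq w].
Proof.
move=> lf fx0; pose S w := M *m w = M *m x0 /\ (f w <= c%:E)%E.
pose F w := if `[< S w >] then (nsq w)%:E else +oo%E.
have FS w l : (F w <= l%:E)%E -> S w /\ nsq w <= l.
  by rewrite /F; case: asboolP => // Sw; rewrite lee_fin.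
have SF w : S w -> F w = (nsq w)%:E by move=> /asboolP Sw; rewrite /F Sw.
have [|||x xmin] := @minimizer_exists R _ F.
- by move=> w; rewrite /F; case: ifP => // _; rewrite ltNyr.
- by exists x0; rewrite SF ?ltry.
- move=> s B sB; have [U UU oU] := nat_ultra; have PU := @ultra_proper _ _ UU.
  have [k|t st] := @bounded_ultra_cvg R _ _ UU _ s B; first by have [] := FS _ _ (sB k).
  exists t => l sl; have St : S t.
    split.
      apply: (cvg_unique (@norm_hausdorff _ _) (cvg_mulmx _ st)).
      rewrite (_ : (fun k => _) = fun=> M *m x0); first exact: cvg_cst.
      by apply/funext => k; have [[->]] := FS _ _ (sB k).
    apply: (@lsc_cvg_le _ _ _ _ _ _ s (fun=> c) _ _ lf st); first exact: cvg_cst.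
    by apply: nearW => k; have [[]] := FS _ _ (sB k).
  rewrite SF// lee_fin.
  apply: (ler_cvg_to (cvg_dot _ st st) (cvg_cst l)).
  by apply: filterS (oU _ sl) => k /FS[].
have Sx : S x.
  by have := xmin x0; rewrite [F x0]SF// => /FS[].
exists x; split; [exact: Sx.1|exact: Sx.2|move=> w Mw fw].
by have := xmin w; rewrite !SF// lee_fin.
Qed.

End closed_convex_functions.

(** * Closedness of the image subdifferential *)

Section kernel_lineality.
Context {R : realType}.

Lemma subdiff_image_closed m n (M : 'M[R]_(m, n)) (f : 'cV[R]_n -> \bar R)
  (U : set_system nat) (UU : UltraFilter U) (x : nat -> 'cV[R]_n)
  (u : nat -> 'cV[R]_m) (v w : 'cV[R]_m) :
  proper_fun f -> lower_semicontinuous f -> convex_efun f ->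
  kernel_lineality M f ->
  (fun k => M *m x k) @ U --> v -> u @ U --> w ->
  (forall k, subdiff f (x k) (M^T *m u k)) ->
  exists2 xs, M *m xs = v & subdiff f xs (M^T *m w).
Proof.
move=> pf lf cf kl xv uw fxu; have PU := @ultra_proper _ _ UU.
have H k : exists pa : 'cV[R]_n * R, [/\ M *m pa.1 = M *m x k,
    (f pa.1 <= pa.2%:E)%E,
    forall w' b, (f w' <= b%:E)%E -> pa.2 + dot (M *m w' - M *m x k) (u k) <= b &
    forall w', M *m w' = M *m x k -> (f w' <= pa.2%:E)%E -> nsq pa.1 <= nsq w'].
  have /(subdiffP _ _ pf)[a fa fxk] := fxu k.
  have [|p [Mp fp pmin]] := @min_norm_exists R _ _ M f (x k) a lf.
    by rewrite fa.
  exists (p, a); split=> // w' b /fxk.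
  by rewrite dot_trmxr mulmxBr.
have [pa paP] := choice H; pose p k := (pa k).1.
have Mp k : M *m p k = M *m x k by have [] := paP k.
(* A subgradient in the range of [M^T] sees a point only through its image by [M], and [f (p k)] is
   no larger than [f (x k)]. *)
have sp k : subdiff f (p k) (M^T *m u k).
  have [_ fp pu _] := paP k; have [a fa ab] := le_EFin_eq pf fp.
  apply/subdiffP => //; exists a => // w' b /pu.
  by rewrite dot_trmxr mulmxBr Mp; lra.
have [[l pl]|[t [d [t01 t0 td d1]]]] := ultra_cvg_or_recede UU p.
  exists l; last exact: (subdiff_closed _ pf lf pl (cvg_mulmx _ uw) sp).
  apply: (cvg_unique (@norm_hausdorff _ _) (cvg_mulmx _ pl)).
  by rewrite (_ : (fun k => _) = fun k => M *m x k)//; apply/funext => k; exact: Mp.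
have Md : M *m d = 0.
  apply: (cvg_unique (@norm_hausdorff _ _) (cvg_mulmx _ td)).
  rewrite (_ : (fun k => _) = fun k => t k *: (M *m x k)); last first.
    by apply/funext => k; rewrite -scalemxAr Mp.
  by rewrite -(scale0r v); exact: cvgZ.
(* Convexity between [p k] and [x'] with weight [t k]: the subgradient inequality bounds [f (p k)]
   by [c k], which converges, so [t k * c k] vanishes. *)
have fd x' b : (f x' <= b%:E)%E -> (f (x' + d)%R <= b%:E)%E.
  move=> fx'; pose c k := b - dot (M *m x' - M *m x k) (u k).
  have cc : c @ U --> b - dot (M *m x' - v) w.
    apply: cvgB; first exact: cvg_cst.
    by apply: cvg_dot => //; apply: cvgB => //; exact: cvg_cst.
  have t1 : (fun k => 1 - t k) @ U --> (1 : R).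
    by rewrite -[X in _ --> X]subr0; apply: cvgB => //; exact: cvg_cst.
  have px : (fun k => t k *: p k + (1 - t k) *: x') @ U --> x' + d.
    by have := cvgD td (cvgZ t1 (cvg_cst x')); rewrite scale1r (addrC d); apply.
  have cb : (fun k => t k * c k + (1 - t k) * b) @ U --> b.
    by have := cvgD (cvgM t0 cc) (cvgM t1 (cvg_cst b)); rewrite mul0r add0r mul1r; apply.
  apply: (lsc_cvg_le _ lf px cb).
  apply: nearW => k; apply: convex_le => //.
  have [_ fp /(_ _ _ fx') pu _] := paP k; apply: le_trans fp _.
  by rewrite lee_fin /c; lra.
(* By [kl], [p k - d] competes with [p k] for the least norm, hence [2 * dot (p k) d <= nsq d = 1].
   Scaled by [t k], this gives [2 * nsq d <= 0] in the limit. *)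
have dp k : 2 * dot (t k *: p k) d <= t k.
  have [_ fp _ /(_ (p k - d))] := paP k; rewrite mulmxBr Md subr0.
  move=> /(_ (Mp k) (kl _ Md fd _ _ fp)); rewrite -/(p k) !dotE d1 (dotC d).
  by have /andP[tk0 _] := t01 k; nra.
have : 2 * dot d d <= 0.
  have c2 : (fun k => 2 * dot (t k *: p k) d) @ U --> 2 * dot d d.
    by apply: cvgM; [exact: cvg_cst|apply: cvg_dot => //; exact: cvg_cst].
  by apply: (ler_cvg_to c2 t0); apply: nearW => k; exact: dp.
by rewrite d1; lra.
Qed.

(** * Conditions that imply kernel lineality *)

Lemma iter_recede n (f : 'cV[R]_n -> \bar R) d :
  (forall x b, (f x <= b%:E)%E -> (f (x + d)%R <= b%:E)%E) ->
  forall k x b, (f x <= b%:E)%E -> (f (x + k%:R *: d)%R <= b%:E)%E.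
Proof.
move=> fd; elim=> [|k IH] x b fx; first by rewrite scale0r addr0.
by rewrite -natr1 scalerDl scale1r addrA; exact/fd/IH.
Qed.

(** The form taken by (B.4), (B.5) and (B.6), which leave no nonzero such direction. *)
Lemma kernel_lineality_eq0 m n (M : 'M[R]_(m, n)) (f : 'cV[R]_n -> \bar R) :
  (forall d, M *m d = 0 ->
    (forall x b, (f x <= b%:E)%E -> (f (x + d)%R <= b%:E)%E) -> d = 0) ->
  kernel_lineality M f.
Proof. by move=> H d Md fd x b fx; rewrite (H d)// subr0. Qed.

Lemma recession_le0P n (f : 'cV[R]_n -> \bar R) d : proper_fun f ->
  (recession f d <= 0)%E <->
  forall x b, (f x <= b%:E)%E -> (f (x + d)%R <= b%:E)%E.
Proof.
move=> pf; split=> [rd x b fx|fd].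
  have [a fa ab] := le_EFin_eq pf fx.
  apply: (@le_trans _ _ a%:E); last by rewrite lee_fin.
  rewrite -[leRHS]add0e -leeBlDr//; apply: le_trans rd; rewrite -fa.
  by apply: ereal_sup_ubound; exists x => //; rewrite /edom /= fa ltry.
apply: ge_ereal_sup => _ [x dx <-]; have [a fa] := edom_EFin pf dx.
by rewrite fa leeBlDr// add0e; apply: fd; rewrite fa.
Qed.

Lemma kernel_lineality_recession m n (M : 'M[R]_(m, n))
  (f : 'cV[R]_n -> \bar R) : proper_fun f ->
  (forall x : 'cV[R]_n,
      (mx_ker M `\` [set x | (- recession f (- x)%R = recession f x)%E /\
                             recession f x = 0%E]) x ->
      (0 < recession f x)%E) ->
  kernel_lineality M f.
Proof.
move=> pf B3 d Md fd; apply/(recession_le0P _ pf).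
have [[E0 E1]|nd] := pselect ((- recession f (- d)%R = recession f d)%E /\
  recession f d = 0%E); first by move: E0; rewrite E1 => /eqP; rewrite oppe_eq0 => /eqP->.
have := B3 d (conj Md nd); rewrite ltNge => /negP; case.
exact/recession_le0P.
Qed.

(** The points [x0 + k.+1%:R *: d] stay in one sublevel set of [f], which is bounded. *)
Lemma kernel_lineality_coercive m n (M : 'M[R]_(m, n))
  (f : 'cV[R]_n -> \bar R) : proper_fun f -> coercive f -> kernel_lineality M f.
Proof.
move=> pf cof; apply: kernel_lineality_eq0 => d _ fd; apply: nsq_eq0.
have [_ [x0 dx0]] := pf; have [a0 fa0] := edom_EFin pf dx0.
have [r Hr] := cof a0.
apply: (@mulS_le_le0 _ _ (2 * r ^+ 2 + 2 * nsq x0)) => k.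
have fk : (f (x0 + k.+1%:R *: d)%R <= a0%:E)%E by apply: iter_recede; rewrite ?fa0.
have er : enorm (x0 + k.+1%:R *: d) <= r.
  by rewrite leNgt; apply/negP => /Hr; rewrite ltNge fk.
have := nsqB_ge (k.+1%:R *: d) (- x0).
rewrite opprK (addrC _ x0) -(enorm_sqr (x0 + _)) dotNl dotNr opprK dotZl dotZr.
have := enorm_ge0 (x0 + k.+1%:R *: d); have := nsq_ge0 d.
move: er; set e := enorm _; set N := nsq d.
rewrite -natr1; have := ler0n R k; set K := k%:R => k0 er N0 e0.
have : e ^+ 2 <= r ^+ 2 by rewrite ler_pXn2r ?nnegrE//; apply: le_trans er.
by nra.
Qed.

(** By the parallelogram identity, the squared norm at the midpoint is below the average by
    [nsq (x - y) / 4]; multiplied by [a / 2] this gives [c = a / 8]. *)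
Lemma strongly_convex_midpoint n (f : 'cV[R]_n -> \bar R) : strongly_convex f ->
  exists2 c, 0 < c & forall x y a b, (f x <= a%:E)%E -> (f y <= b%:E)%E ->
    (f (2^-1 *: x + (1 - 2^-1) *: y)%R
      <= ((a + b) / 2 - c * nsq (x - y))%:E)%E.
Proof.
move=> [a a0 cf]; exists (a / 8); first by lra.
move=> x y r s fr fs.
have h01 : 0 < (2^-1 : R) < 1 by apply/andP; split; lra.
have sub w c : (f w <= c%:E)%E ->
    (f w - (a / 2 * enorm w ^+ 2)%:E <= (c - a / 2 * enorm w ^+ 2)%:E)%E.
  by move=> fc; rewrite EFinB leeD2r.
have := convex_le cf h01 (sub _ _ fr) (sub _ _ fs).
rewrite -EFinN lee_addEFin => /le_trans; apply; rewrite lee_fin !enorm_sqr.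
by rewrite !dotE (dotC y x); lra.
Qed.

(** The midpoint of [x0] and [x0 + 2 (k + 1) d] has value at most [a0 - 4 c (k + 1)^2 |d|^2], and at
    least [- C - c (k + 1)^2 |d|^2] by the quadratic bound with the same [c]. *)
Lemma kernel_lineality_strongly_convex m n (M : 'M[R]_(m, n))
  (f : 'cV[R]_n -> \bar R) :
  proper_fun f -> lower_semicontinuous f -> convex_efun f ->
  strongly_convex f -> kernel_lineality M f.
Proof.
move=> pf lf cf /strongly_convex_midpoint[c c0 Hc].
apply: kernel_lineality_eq0 => d _ fd; apply: nsq_eq0.
have [_ [x0 dx0]] := pf; have [a0 fa0] := edom_EFin pf dx0.
have fx0 : (f x0 <= a0%:E)%E by rewrite fa0.
have [C HC] := convex_quad_lower_bound x0 pf lf cf c0.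
apply: (@mulS_le_le0 _ _ ((a0 + C) / (3 * c))) => k.
have := HC _ _ (Hc _ _ _ _ (iter_recede fd (2 * k.+1) fx0) fx0).
rewrite [x0 + _]addrC addrK.
have -> : 2^-1 *: ((2 * k.+1)%:R *: d + x0) + (1 - 2^-1) *: x0 - x0 = k.+1%:R *: d.
  by rewrite natrM; apply/matrixP => i j; rewrite !mxE; field.
rewrite natrM ler_pdivlMr ?mulr_gt0// !dotE -natr1.
set K := k%:R; set N := nsq d.
have cKN : 0 <= c * K * N by rewrite !mulr_ge0 ?nsq_ge0 ?ler0n ?(ltW c0).
have cKKN : 0 <= c * K * K * N by rewrite !mulr_ge0 ?nsq_ge0 ?ler0n ?(ltW c0).
lra.
Qed.

Lemma kernel_lineality_unitmx m n (M : 'M[R]_(m, n)) (f : 'cV[R]_n -> \bar R) :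
  M^T *m M \in unitmx -> kernel_lineality M f.
Proof.
move=> uM; apply: kernel_lineality_eq0 => d Md _.
by rewrite -(mulKmx uM d) -mulmxA Md !mulmx0.
Qed.

Lemma fenchel_conjP n (f : 'cV[R]_n -> \bar R) u : proper_fun f ->
  edom (fenchel_conj f) u <->
  exists c, forall w b, (f w <= b%:E)%E -> dot u w - b <= c.
Proof.
move=> pf; split=> [du|[c uc]].
  have [_ [x0 dx0]] := pf; have [a0 fa0] := edom_EFin pf dx0.
  have ub w a : f w = a%:E -> ((dot u w - a)%:E <= fenchel_conj f u)%E.
    by move=> fa; apply: ereal_sup_ubound; exists w => //; rewrite fa.
  move: du ub; rewrite /edom /=; case: (fenchel_conj f u) => // [c|] _ ub.
    exists c => w b fb; have [a fa ab] := le_EFin_eq pf fb.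
    by have := ub _ _ fa; rewrite lee_fin; lra.
  by have := ub _ _ fa0.
apply: (@le_lt_trans _ _ c%:E); last exact: ltry.
apply: ge_ereal_sup => _ [w _ <-]; case E : (f w) => [a| |].
- by rewrite lee_fin; apply: uc; rewrite E.
- by rewrite addeNy leNye.
- by have := pf.1 w; rewrite E.
Qed.

(** A subgradient [u] at [v] makes [v] a maximizer of [dot u w - f w]. *)
Lemma subdiff_sub_edom_conj n (f : 'cV[R]_n -> \bar R) : proper_fun f ->
  set_ran (subdiff f) `<=` edom (fenchel_conj f).
Proof.
move=> pf u [v _ /(subdiffP _ _ pf)[a _ vu]]; apply/fenchel_conjP => //.
by exists (dot u v - a) => w b /vu; rewrite dotC dotDr dotNr; lra.
Qed.

(** Otherwise [dot u w - f w] would be unbounded along the points [x0 + k.+1%:R *: d]. *)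
Lemma recede_dot_le0 n (f : 'cV[R]_n -> \bar R) d u : proper_fun f ->
  (forall x b, (f x <= b%:E)%E -> (f (x + d)%R <= b%:E)%E) ->
  edom (fenchel_conj f) u -> dot d u <= 0.
Proof.
move=> pf fd /(fenchel_conjP _ pf)[c uc].
have [_ [x0 dx0]] := pf; have [a0 fa0] := edom_EFin pf dx0.
apply: (@mulS_le_le0 _ _ (c + a0 - dot u x0)) => k.
have fx0 : (f x0 <= a0%:E)%E by rewrite fa0.
have := uc _ _ (iter_recede fd k.+1 fx0).
by rewrite dotDr dotZr (dotC d u); lra.
Qed.

(** For a subgradient [u], prolonging from [u] past 0 gives [u' = M^T q - e u] in the domain of the
    conjugate; as [M d = 0], [dot d u' <= 0] becomes [0 <= dot d u]. *)
Lemma kernel_lineality_conj m n (M : 'M[R]_(m, n)) (f : 'cV[R]_n -> \bar R) :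
  proper_fun f -> lower_semicontinuous f -> convex_efun f ->
  rel_interior (set_sub (edom (fenchel_conj f)) (mx_range M^T)) 0 ->
  kernel_lineality M f.
Proof.
move=> pf lf cf ri d Md fd; apply: le_subr_subdiff_ge0 => // v u uv.
have du : edom (fenchel_conj f) u by apply: subdiff_sub_edom_conj => //; exists v.
have [|e e0] := @rel_interior_extend _ _ _ _ u ri.
  by exists u => //; exists 0; [exists 0; rewrite ?mulmx0|rewrite subr0].
move=> [u' du' [_ [q _ <-]]]; rewrite add0r sub0r => E.
have := recede_dot_le0 pf fd du'.
have -> : u' = M^T *m q - e *: u by rewrite -scalerN -E addrC subrK.
by rewrite dotDr dot_trmxr Md dot0l dotNr dotZr; nra.
Qed.

(** The same prolongation, past a point [p = M^T q], which is orthogonal to [d]. *)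
Lemma kernel_lineality_ran_subdiff m n (M : 'M[R]_(m, n))
  (f : 'cV[R]_n -> \bar R) :
  proper_fun f -> lower_semicontinuous f -> convex_efun f ->
  rel_interior (set_ran (subdiff f)) `&` mx_range M^T !=set0 ->
  kernel_lineality M f.
Proof.
move=> pf lf cf [p [ri [q _ Ep]]] d Md fd; apply: le_subr_subdiff_ge0 => // v u uv.
have [|e e0 /(subdiff_sub_edom_conj pf)/(recede_dot_le0 pf fd)] :=
  @rel_interior_extend _ _ _ _ u ri; first by exists v.
rewrite -Ep dotDr dotZr dotDr dotNr dot_trmxr Md dot0l; nra.
Qed.

End kernel_lineality.

(** * Existence of critical points *)

Section multipliers.
Context {R : realType} {m n : nat}.
Variables (M : 'M[R]_(m, n)) (f : 'cV[R]_n -> \bar R) (g : 'cV[R]_m -> \bar R).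
Hypotheses (pf : proper_fun f) (lf : lower_semicontinuous f)
  (cf : convex_efun f) (pg : proper_fun g) (lg : lower_semicontinuous g)
  (cg : convex_efun g).

Lemma le_addEFin_fin x z (q l : R) : (f x + g z + q%:E <= l%:E)%E ->
  exists a b, [/\ f x = a%:E, g z = b%:E & a + b + q <= l].
Proof.
have := pf.1 x; have := pg.1 z; case: (f x) (g z) => [a| |] [b| |]//.
by exists a, b; rewrite -?EFinD ?lee_fin in H *.
Qed.

Lemma optimal_finite xs zs x z a b : optimal_solution M f g xs zs ->
  M *m x = z -> f x = a%:E -> g z = b%:E ->
  exists p q, [/\ f xs = p%:E, g zs = q%:E & p + q <= a + b].
Proof.
move=> [_ opt] Mx fx gz; have := opt x z Mx.
by rewrite fx gz -EFinD -[leLHS]adde0 => /le_addEFin_fin[p [q]]; rewrite addr0; exists p, q.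
Qed.

Lemma saddle_critical xs zs ys :
  saddle_point M f g xs zs ys -> critical_point M f g xs zs ys.
Proof.
move=> sad; have [_ [x0 dx0]] := pf; have [_ [z0 dz0]] := pg.
have [a0 fx0] := edom_EFin pf dx0; have [b0 gz0] := edom_EFin pg dz0.
have [p [q [fp gq _]]] : exists p q, [/\ f xs = p%:E, g zs = q%:E &
    p + q + coupling M 0 xs zs ys <= a0 + b0 + coupling M 0 x0 z0 ys].
  by apply: le_addEFin_fin; have [_] := sad x0 z0 ys; rewrite /aug_lagrangian fx0 gz0.
have c0 x z y : coupling M 0 x z y = dot y (M *m x - z).
  by rewrite /coupling !mul0r addr0.
have Mz : M *m xs - zs = 0.
  (* Moving [ys] by the residual raises the Lagrangian by the squared residual, which the left
     saddle inequality forbids unless it is 0. *)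
  apply: nsq_eq0; have [+ _] := sad xs zs (ys + (M *m xs - zs)).
  by rewrite /aug_lagrangian !c0 fp gq -!EFinD lee_fin dotDl; lra.
have lag x z a b : (f x <= a%:E)%E -> (g z <= b%:E)%E ->
    p + q <= a + b + dot ys (M *m x - z).
  move=> /(le_EFin_eq pf)[a' fx aa'] /(le_EFin_eq pg)[b' gz bb'].
  have [_] := sad x z ys; rewrite /aug_lagrangian !c0 fp gq fx gz Mz dot0r.
  by rewrite -!EFinD lee_fin; lra.
have Mzs : zs = M *m xs by apply/esym/eqP; rewrite -subr_eq0 Mz.
(* Freezing [z = zs], then [x = xs], turns the right saddle inequality into the two subgradient
   inequalities. *)
split=> //; apply/subdiffP => //.
  exists p => // w b fw; have := lag w zs b q fw; rewrite gq => /(_ (lexx _)).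
  by rewrite Mzs -mulmxBr dotNr dot_trmxr (dotC ys); lra.
exists q => // w b gw; have := lag xs w p b _ gw; rewrite fp => /(_ (lexx _)).
by rewrite -Mzs (dotC ys) -opprB dotNl; lra.
Qed.

(** In the sum of the two subgradient inequalities the multiplier terms cancel when [M *m x = z]. *)
Lemma critical_optimal xs zs ys :
  critical_point M f g xs zs ys -> optimal_solution M f g xs zs.
Proof.
move=> [/(subdiffP _ _ pf)[a fa fu] /(subdiffP _ _ pg)[b gb gu] Mz].
have Mzs : M *m xs = zs by apply/eqP; rewrite -subr_eq0 Mz.
split=> // x z Mxz; rewrite fa gb -EFinD.
have := pf.1 x; have := pg.1 z.
case Ef : (f x) => [a'| |]; case Eg : (g z) => [b'| |]//= _ _; rewrite ?leey//.
rewrite -EFinD lee_fin.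
have := fu x a'; rewrite Ef => /(_ (lexx _)); have := gu z b'.
rewrite Eg => /(_ (lexx _)); rewrite dotNr dot_trmxr mulmxBr Mxz Mzs; lra.
Qed.

(** * Quadratically penalized problems and their multipliers *)

Let quad_lower_bound2 xs zs : exists C, forall x z a b,
  (f x <= a%:E)%E -> (g z <= b%:E)%E ->
  [/\ - C - 1/4 * nsq (x - xs) <= a & - C - 1/4 * nsq (z - zs) <= b].
Proof.
have q0 : 0 < 1/4 :> R by lra.
have [C1 H1] := convex_quad_lower_bound xs pf lf cf q0.
have [C2 H2] := convex_quad_lower_bound zs pg lg cg q0.
exists (`|C1| + `|C2|) => x z a b /H1 fa /H2 gb.
have := ler_norm C1; have := ler_norm C2.
have := normr_ge0 C1; have := normr_ge0 C2.
by split; lra.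
Qed.

(** The coefficients [1/2] beat the minorants with [1/4], so all four sequences are bounded. It
    serves for minimizing sequences of one penalized problem and for the sequence of penalized
    minimizers. *)
Lemma joint_ultra_cvg (U : set_system nat) (UU : UltraFilter U) xs zs
  (x : nat -> 'cV[R]_n) (z : nat -> 'cV[R]_m) (a b : nat -> R) B :
  (forall k, (f (x k) <= (a k)%:E)%E) -> (forall k, (g (z k) <= (b k)%:E)%E) ->
  (forall k, a k + b k + 1/2 * nsq (x k - xs) + 1/2 * nsq (z k - zs) <= B) ->
  exists (x' : 'cV[R]_n) (z' : 'cV[R]_m) (a' b' : R),
    [/\ (f x' <= a'%:E)%E, (g z' <= b'%:E)%E,
        (x @ U --> x') /\ (z @ U --> z'), (a @ U --> a') /\ (b @ U --> b')
      & exists C, forall k, - C <= a k + b k].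
Proof.
move=> fa gb abB; have PU := @ultra_proper _ _ UU.
have [C HC] := quad_lower_bound2 xs zs.
pose K := 4 * (B + 2 * C).
have nK k : [/\ nsq (x k - xs) <= K, nsq (z k - zs) <= K,
    - C - K <= a k <= B + C + K & - C - K <= b k <= B + C + K].
  have [ha hb] := HC _ _ _ _ (fa k) (gb k); have := abB k.
  have := nsq_ge0 (x k - xs); have := nsq_ge0 (z k - zs).
  by rewrite /K; split; lra.
have [k|x' xx'] := @bounded_ultra_cvg _ _ _ UU _ x (2 * K + 2 * nsq xs).
  by have := nsqB_ge (x k) xs; have [] := nK k; lra.
have [k|z' zz'] := @bounded_ultra_cvg _ _ _ UU _ z (2 * K + 2 * nsq zs).
  by have := nsqB_ge (z k) zs; have [] := nK k; lra.
have [k|a' aa'] := @bounded_ultra_cvgr _ _ _ UU a (- C - K) (B + C + K).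
  by have [] := nK k.
have [k|b' bb'] := @bounded_ultra_cvgr _ _ _ UU b (- C - K) (B + C + K).
  by have [] := nK k.
exists x', z', a', b'; split=> //.
- by apply: (lsc_cvg_le _ lf xx' aa'); exact: nearW.
- by apply: (lsc_cvg_le _ lg zz' bb'); exact: nearW.
- by exists (2 * (C + K)) => k; have [_ _ /andP[? _] /andP[? _]] := nK k; lra.
Qed.

(** The two proximal terms make minimizers exist and later force them to converge to [(xs, zs)]. The
    subgradients come from minimality in each variable separately. *)
Lemma penalized_minimizer xs zs p q c : 0 < c ->
  f xs = p%:E -> g zs = q%:E -> M *m xs = zs ->
  exists x z a b, [/\ f x = a%:E, g z = b%:E,
    a + b + c / 2 * nsq (M *m x - z) + 1/2 * nsq (x - xs) + 1/2 * nsq (z - zs)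
      <= p + q,
    subdiff f x (- (M^T *m (c *: (M *m x - z)) + (x - xs))) &
    subdiff g z (c *: (M *m x - z) - (z - zs))].
Proof.
move=> c0 fp gq Mzs.
pose Q x z : R :=
  c / 2 * nsq (M *m x - z) + 1/2 * nsq (x - xs) + 1/2 * nsq (z - zs).
pose F (xz : 'cV[R]_n * 'cV[R]_m) := (f xz.1 + g xz.2 + (Q xz.1 xz.2)%:E)%E.
have Fpq : F (xs, zs) = (p + q)%:E.
  by rewrite /F/= fp gq /Q Mzs !subrr !dot0l !mulr0 !addr0.
have [|||[x z] Fmin] := @minimizer_exists R _ F.
- move=> [x z]; rewrite /F /=.
  by have := pf.1 x; have := pg.1 z; case: (f x) (g z) => [?| |] [?| |]//= _ _; rewrite ltNyr.
- by exists (xs, zs); rewrite Fpq ltry.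
- move=> s B sB; have [U UU oU] := nat_ultra; have PU := @ultra_proper _ _ UU.
  have H k : exists ab : R * R, [/\ f (s k).1 = ab.1%:E, g (s k).2 = ab.2%:E &
      ab.1 + ab.2 + Q (s k).1 (s k).2 <= B].
    by have [a [b abP]] := le_addEFin_fin (sB k); exists (a, b).
  have [ab abP] := choice H.
  have [|||x' [z' [a' [b' [fx' gz' [xx' zz'] [aa' bb'] _]]]]] :=
    @joint_ultra_cvg U UU xs zs (fst \o s) (snd \o s) (fst \o ab) (snd \o ab) B.
  + by move=> k; have [-> _ _] := abP k.
  + by move=> k; have [_ -> _] := abP k.
  + move=> k; have [_ _] := abP k; rewrite /Q /=.
    have : 0 <= c / 2 * nsq (M *m (s k).1 - (s k).2).
      by rewrite mulr_ge0 ?nsq_ge0// divr_ge0// ltW.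
    by lra.
  exists (x', z') => l sl; rewrite /F /=.
  apply: (@le_trans _ _ (a' + b' + Q x' z')%:E).
    by rewrite !EFinD; apply: leeD => //; exact: leeD.
  rewrite lee_fin; have Qc : (fun k => Q (s k).1 (s k).2) @ U --> Q x' z'.
    have nc N (u v : nat -> 'cV[R]_N) (u' v' : 'cV[R]_N) e :
        u @ U --> u' -> v @ U --> v' ->
        (fun k => e * nsq (u k - v k)) @ U --> e * nsq (u' - v').
      move=> uu' vv'; apply: cvgM; first exact: cvg_cst.
      by apply: cvg_dot; exact: cvgB.
    apply: cvgD; last by apply: nc => //; exact: cvg_cst.
    apply: cvgD; last by apply: nc => //; exact: cvg_cst.
    by apply: nc => //; exact: cvg_mulmx.
  apply: (ler_cvg_to (cvgD (cvgD aa' bb') Qc) (cvg_cst l)).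
  apply: filterS (oU _ sl) => k; rewrite /F; have [-> -> _] := abP k.
  by rewrite -!EFinD lee_fin.
have [a [b [fa gb ab]]] : exists a b, [/\ f x = a%:E, g z = b%:E &
    a + b + Q x z <= p + q].
  by apply: le_addEFin_fin; rewrite -Fpq; exact: Fmin.
exists x, z, a, b; split=> //.
- by move: ab; rewrite /Q !addrA.
- apply: (@minimizer_subdiff _ _ _ (fun x' => Q x' z)) => //.
    move=> w; have := Fmin (w, z); rewrite /F /= gb.
    by rewrite !(addeAC _ b%:E) leeD2rE.
  move=> w; exists (c / 2 * nsq (M *m (w - x)) + 1/2 * nsq (w - x)) => t _.
  rewrite /Q.
  have -> : M *m (t *: w + (1 - t) *: x) - z = M *m x - z + t *: (M *m (w - x)).
    rewrite mulmxDr mulmxBr -!scalemxAr.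
    by move: (M *m w) (M *m x) => ? ?; vec_ring.
  have -> : t *: w + (1 - t) *: x - xs = x - xs + t *: (w - x) by vec_ring.
  rewrite (dotDr (w - x)) dot_trmxr.
  move: (M *m x - z) (M *m (w - x)) => e1 e2; move: (x - xs) (w - x) => e3 e4.
  by rewrite !dotE (dotC e2) (dotC e4); field.
- rewrite -[_ - _]opprK; apply: (@minimizer_subdiff _ _ _ (fun z' => Q x z')) => //.
    move=> w; have := Fmin (x, w); rewrite /F /= fa -!addeA.
    by rewrite leeD2lE.
  move=> w; exists (c / 2 * nsq (w - z) + 1/2 * nsq (w - z)) => t _.
  rewrite /Q.
  have -> : M *m x - (t *: w + (1 - t) *: z) = M *m x - z - t *: (w - z).
    by move: (M *m x) => ?; vec_ring.
  have -> : t *: w + (1 - t) *: z - zs = z - zs + t *: (w - z) by vec_ring.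
  move: (M *m x - z) (z - zs) (w - z) => e1 e3 e4.
  by rewrite !dotE (dotC e4 e1) (dotC e4 e3); field.
Qed.

(* The multipliers of the penalized problems converge to one of the constrained
   problem: otherwise they escape in a direction [d] with [<d, w> <= 0] on
   [D = dom g - M dom f], hence [<d, w> = 0] there since [0] is in [ri D]; but
   the multipliers lie in the cone spanned by [- D]. *)
Lemma multiplier_exists xs zs : optimal_solution M f g xs zs ->
  rel_interior (set_sub (edom g) [set M *m x | x in edom f]) 0 ->
  exists ys, critical_point M f g xs zs ys.
Proof.
move=> opt ri.
(* Membership of 0 in [dom g - M dom f] provides a feasible point, which makes the optimal value
   finite. *)
have [p [q [fp gq pq]]] : exists p q, [/\ f xs = p%:E, g zs = q%:E &
    forall x z a b, M *m x = z -> f x = a%:E -> g z = b%:E -> p + q <= a + b].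
  have [[z0 dz0 [_ [x0 dx0 <-] zx0]] _] := ri.
  have [a0 fx0] := edom_EFin pf dx0; have [b0 gz0] := edom_EFin pg dz0.
  have Mx0 : M *m x0 = z0 by apply/esym/eqP; rewrite -subr_eq0 zx0.
  have [p [q [fp gq _]]] := optimal_finite opt Mx0 fx0 gz0.
  exists p, q; split=> // x z a b Mx fx gz.
  have [p' [q' []]] := optimal_finite opt Mx fx gz.
  by rewrite fp gq => -[->] [->].
have Mzs := opt.1.
have H (k : nat) : exists s : 'cV[R]_n * 'cV[R]_m * (R * R), let: (x, z, (a, b)) := s in
    [/\ f x = a%:E, g z = b%:E,
    a + b + k.+1%:R / 2 * nsq (M *m x - z) + 1/2 * nsq (x - xs) +
      1/2 * nsq (z - zs) <= p + q,
    subdiff f x (- (M^T *m (k.+1%:R *: (M *m x - z)) + (x - xs))) &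
    subdiff g z (k.+1%:R *: (M *m x - z) - (z - zs))].
  have [x [z [a [b P]]]] := penalized_minimizer (ltr0Sn R k) fp gq Mzs.
  by exists (x, z, (a, b)).
have [s sP] := choice H; pose x k := (s k).1.1; pose z k := (s k).1.2.
pose a k := (s k).2.1; pose b k := (s k).2.2.
pose y k := k.+1%:R *: (M *m x k - z k).
have {}sP k : [/\ f (x k) = (a k)%:E, g (z k) = (b k)%:E,
    a k + b k + k.+1%:R / 2 * nsq (M *m x k - z k) + 1/2 * nsq (x k - xs) +
      1/2 * nsq (z k - zs) <= p + q,
    subdiff f (x k) (- (M^T *m y k + (x k - xs))) &
    subdiff g (z k) (y k - (z k - zs))].
  by have := sP k; rewrite /y /x /z /a /b; case: (s k) => -[? ?] [? ?].
have pen k : 0 <= k.+1%:R / 2 * nsq (M *m x k - z k).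
  by rewrite mulr_ge0 ?nsq_ge0// divr_ge0.
have [U UU oU] := nat_ultra; have PU := @ultra_proper _ _ UU.
have [|||x' [z' [a' [b' [fx' gz' [xx' zz'] [aa' bb'] [C HC]]]]]] :=
    @joint_ultra_cvg U UU xs zs x z a b (p + q).
- by move=> k; have [-> _ _ _ _] := sP k.
- by move=> k; have [_ -> _ _ _] := sP k.
- by move=> k; have [_ _ h _ _] := sP k; have := pen k; lra.
have Mxz : M *m x' = z'.
  (* The penalty, [k.+1%:R / 2] times the squared residual, stays bounded. *)
  have r0 : (fun k => M *m x k - z k) @ U --> (0 : 'cV[R]_m).
    apply: cvg_nsq0; apply: cvg_trans (cvg_app _ oU) _.
    apply: (@cvg0_of_mulS_le _ _ (2 * (p + q + C))) => k; rewrite subr0.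
      exact: nsq_ge0.
    have [_ _ h _ _] := sP k; have := HC k.
    by have := nsq_ge0 (x k - xs); have := nsq_ge0 (z k - zs); lra.
  have Mz : (fun k => M *m x k) @ U --> z'.
    rewrite (_ : (fun k => _) = fun k => (M *m x k - z k) + z k); last first.
      by apply/funext => k; rewrite subrK.
    by rewrite -[z']add0r; exact: cvgD.
  exact: (cvg_unique (@norm_hausdorff _ _) (cvg_mulmx _ xx') Mz).
(* Optimality of [(xs, zs)] gives the reverse inequality without the proximal terms, so these
   vanish. *)
have lim : a' + b' + 1/2 * nsq (x' - xs) + 1/2 * nsq (z' - zs) <= p + q.
  have nc N (u : nat -> 'cV[R]_N) (u' v : 'cV[R]_N) : u @ U --> u' ->
      (fun k => 1/2 * nsq (u k - v)) @ U --> 1/2 * nsq (u' - v).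
    move=> uu'; apply: cvgM; first exact: cvg_cst.
    by apply: cvg_dot; apply: cvgB => //; exact: cvg_cst.
  have cc : (fun k => a k + b k + 1/2 * nsq (x k - xs) + 1/2 * nsq (z k - zs)) @ U
      --> a' + b' + 1/2 * nsq (x' - xs) + 1/2 * nsq (z' - zs).
    by apply: cvgD (nc _ _ _ zs zz'); apply: cvgD (nc _ _ _ xs xx'); exact: cvgD.
  apply: (ler_cvg_to cc (cvg_cst (p + q))); apply: nearW => k.
  by have [_ _ h _ _] := sP k; have := pen k; lra.
have [a'' fx'' a''a'] := le_EFin_eq pf fx'.
have [b'' gz'' b''b'] := le_EFin_eq pg gz'.
have := pq _ _ _ _ Mxz fx'' gz''; have := nsq_ge0 (x' - xs).
have := nsq_ge0 (z' - zs) => zge xge pq'.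
have E1 : x' = xs by apply/eqP; rewrite -subr_eq0; apply/eqP/nsq_eq0; lra.
have E2 : z' = zs by apply/eqP; rewrite -subr_eq0; apply/eqP/nsq_eq0; lra.
have dx : (fun k => x k - xs) @ U --> (0 : 'cV[R]_n).
  by have := cvgB xx' (cvg_cst xs); rewrite E1 subrr; apply.
have dz : (fun k => z k - zs) @ U --> (0 : 'cV[R]_m).
  by have := cvgB zz' (cvg_cst zs); rewrite E2 subrr; apply.
have [[ys yys]|[t [d [t01 t0 td d1]]]] := ultra_cvg_or_recede UU y.
  exists ys; split; last by rewrite Mzs subrr.
    have c : (fun k => - (M^T *m y k + (x k - xs))) @ U --> - (M^T *m ys).
      apply: cvgN; rewrite -[X in _ --> X]addr0.
      by apply: cvgD => //; exact: cvg_mulmx.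
    rewrite -E1; apply: (subdiff_closed _ pf lf xx' c) => k.
    by have [] := sP k.
  have c : (fun k => y k - (z k - zs)) @ U --> ys.
    by have := cvgB yys dz; rewrite subr0; apply.
  by rewrite -E2; apply: (subdiff_closed _ pg lg zz' c) => k; have [] := sP k.
have dle w : set_sub (edom g) [set M *m x | x in edom f] w -> dot d w <= 0.
  move=> [w1 dw1 [_ [w2 dw2 <-] <-]].
  have [r1 gw1] := edom_EFin pg dw1; have [r2 fw2] := edom_EFin pf dw2.
  (* The sum of the subgradient inequalities at [x k] and [z k], with
     [dot (y k) (M *m x k - z k) >= 0] dropped, gives [dot (y k) (w1 - M *m w2) <= h k]. As [h]
     converges, scaling by [t k] leaves 0 on the right. *)
  pose h k := r1 + r2 - a k - b k + dot (w2 - x k) (x k - xs)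
     + dot (w1 - z k) (z k - zs).
  have hc : h @ U --> r1 + r2 - a' - b' + dot (w2 - x') 0 + dot (w1 - z') 0.
    apply: cvgD; last by apply: cvg_dot => //; apply: cvgB => //; exact: cvg_cst.
    apply: cvgD; last by apply: cvg_dot => //; apply: cvgB => //; exact: cvg_cst.
    by apply: cvgB => //; apply: cvgB => //; exact: cvg_cst.
  have c1 : (fun k => dot (t k *: y k) (w1 - M *m w2)) @ U --> dot d (w1 - M *m w2).
    by apply: cvg_dot => //; exact: cvg_cst.
  have c2 : (fun k => t k * h k) @ U --> (0 : R).
    by have := cvgM t0 hc; rewrite mul0r; apply.
  apply: (ler_cvg_to c1 c2); apply: nearW => k; rewrite dotZl.
  rewrite ler_wpM2l//; first by have /andP[/ltW] := t01 k.
  have [fa gb _ /(subdiffP _ _ pf)[a1 fa1 sf] /(subdiffP _ _ pg)[b1 gb1 sg]] := sP k.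
  have := sf w2 r2; have := sg w1 r1; rewrite gw1 fw2 => /(_ (lexx _)) h1 /(_ (lexx _)) h2.
  move: fa1 gb1; rewrite fa gb => -[E3] [E4]; rewrite -E3 in h2; rewrite -E4 in h1.
  have yr : 0 <= dot (y k) (M *m x k - z k).
    by rewrite dotZl mulr_ge0 ?nsq_ge0.
  rewrite dotNr dotDr dot_trmxr mulmxBr (dotC _ (y k)) in h2.
  rewrite dotDr dotNr (dotC _ (y k)) in h1.
  move: h1 h2 yr; rewrite /h.
  move: (dot (w2 - _) _) (dot (w1 - _) (z k - _)) => D1 D2.
  by rewrite !(dotDr (y k)) !(dotNr (y k)); lra.
have d0 w : set_sub (edom g) [set M *m x | x in edom f] w -> dot d w = 0.
  move=> Dw; have [e e0 /dle] := rel_interior_extend ri Dw.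
  by rewrite add0r sub0r dotZr dotNr; have := dle _ Dw; nra.
have dy k : dot (t k *: y k) d = 0.
  have [fa gb _ _ _] := sP k.
  have /d0 : set_sub (edom g) [set M *m x | x in edom f] (z k - M *m x k).
    exists (z k); first by rewrite /edom /= gb ltry.
    by exists (M *m x k) => //; exists (x k) => //; rewrite /edom /= fa ltry.
  by rewrite -opprB dotNr dotZl dotZl (dotC d) => /eqP; rewrite oppr_eq0 => /eqP->; rewrite !mulr0.
have : dot d d = 0.
  apply: (cvg_unique (@norm_hausdorff _ _) (cvg_dot _ td (cvg_cst d))).
  rewrite (_ : (fun k => _) = fun=> 0); first exact: cvg_cst.
  by apply/funext => k; exact: dy.
by rewrite d1 => /eqP; rewrite oner_eq0.
Qed.

End multipliers.

(** * Convergence of the ADMM *)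

Lemma subdiff_monotone (R : realType) n (f : 'cV[R]_n -> \bar R) x x' u u' :
  proper_fun f -> subdiff f x u -> subdiff f x' u' ->
  0 <= dot (x - x') (u - u').
Proof.
move=> pf /(subdiffP _ _ pf)[a fa fu] /(subdiffP _ _ pf)[a' fa' fu'].
have := fu x' a'; rewrite fa' => /(_ (lexx _)).
have := fu' x a; rewrite fa => /(_ (lexx _)).
by rewrite !dotE; lra.
Qed.

(** Both subgradient inequalities are tested at the midpoint, where the gain [c] ends up counted
    four times. *)
Lemma subdiff_strongly_monotone (R : realType) n (f : 'cV[R]_n -> \bar R) :
  proper_fun f -> strongly_convex f -> exists2 c, 0 < c &
  forall x x' u u', subdiff f x u -> subdiff f x' u' ->
    c * nsq (x - x') <= dot (x - x') (u - u').
Proof.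
move=> pf /strongly_convex_midpoint[c c0 Hc]; exists (4 * c); first by lra.
move=> x x' u u' /(subdiffP _ _ pf)[a fa fu] /(subdiffP _ _ pf)[a' fa' fu'].
have := Hc x x' a a'; rewrite fa fa' => /(_ (lexx _) (lexx _)) mid.
have := fu _ _ mid; have := fu' _ _ mid.
have -> : 2^-1 *: x + (1 - 2^-1) *: x' - x = - (2^-1 *: (x - x')).
  by apply/matrixP => i j; rewrite !mxE; field.
have -> : 2^-1 *: x + (1 - 2^-1) *: x' - x' = 2^-1 *: (x - x').
  by apply/matrixP => i j; rewrite !mxE; field.
by move: (x - x') => d; rewrite !(dotZl, dotNl, dotNr, dotDr); lra.
Qed.

(** * Optimality conditions of the updates and Lyapunov descent *)

Section admm_convergence.
Context {R : realType} {m n : nat}.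
Variables (M : 'M[R]_(m, n)) (f : 'cV[R]_n -> \bar R) (g : 'cV[R]_m -> \bar R).
Hypotheses (pf : proper_fun f) (cf : convex_efun f) (pg : proper_fun g)
  (cg : convex_efun g).
Variables (gamma : R) (x : nat -> 'cV[R]_n) (z y : nat -> 'cV[R]_m).
Hypotheses (gamma_gt0 : 0 < gamma) (xzy : admm M f g gamma x z y).

(** Minimality yields the multiplier [y k + gamma *: (M *m x k.+1 - z k)], rewritten by the update
    of [y]. The sign stays inside [M^T] to fit [subdiff_image_closed]. *)
Lemma admm_subdiff_x k : subdiff f (x k.+1)
  (M^T *m (- (y k.+1 + gamma *: (z k.+1 - z k)))).
Proof.
have [xmin _ yE] := xzy k; rewrite mulmxN.
apply: minimizer_subdiff xmin _ => // w.
exists (gamma / 2 * nsq (M *m (w - x k.+1))) => t _.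
rewrite /coupling !enorm_sqr dot_trmxr yE.
have -> : M *m (t *: w + (1 - t) *: x k.+1) - z k =
    M *m x k.+1 - z k + t *: (M *m (w - x k.+1)).
  rewrite mulmxDr mulmxBr -!scalemxAr.
  by move: (M *m w) (M *m x k.+1) => ? ?; vec_ring.
have -> : y k + gamma *: (M *m x k.+1 - z k.+1) + gamma *: (z k.+1 - z k) =
    y k + gamma *: (M *m x k.+1 - z k).
  by move: (M *m x k.+1) => ?; vec_ring.
move: (M *m x k.+1 - z k) (M *m (w - x k.+1)) => e1 e2.
by rewrite !dotE (dotC e2 e1) (dotC e2 (y k)); field.
Qed.

Lemma admm_subdiff_z k : subdiff g (z k.+1) (y k.+1).
Proof.
have [_ zmin yE] := xzy k; rewrite -[y _]opprK.
apply: minimizer_subdiff zmin _ => // w.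
exists (gamma / 2 * nsq (w - z k.+1)) => t _.
rewrite /coupling !enorm_sqr yE.
have -> : M *m x k.+1 - (t *: w + (1 - t) *: z k.+1) =
    M *m x k.+1 - z k.+1 - t *: (w - z k.+1).
  by move: (M *m x k.+1) => ?; vec_ring.
move: (M *m x k.+1 - z k.+1) (w - z k.+1) => e1 e2.
by rewrite !dotE (dotC e2 e1) (dotC e2 (y k)); field.
Qed.

(** [gamma] times the usual squared distance with weights [gamma^-1] on [y] and [gamma] on [z]. *)
Definition lyapunov (zs ys : 'cV[R]_m) k :=
  nsq (y k - ys) + gamma ^+ 2 * nsq (z k - zs).

Let gamma2_nsq_ge0 N (u : 'cV[R]_N) : 0 <= gamma ^+ 2 * nsq u.
Proof. by rewrite mulr_ge0 ?nsq_ge0// sqr_ge0. Qed.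

Lemma lyapunov_ge0 zs ys k : 0 <= lyapunov zs ys k.
Proof. by rewrite addr_ge0 ?nsq_ge0 ?gamma2_nsq_ge0. Qed.

(* The index starts at 1 because [y 0] need not be a subgradient of [g] at [z 0]. *)
Lemma lyapunov_descent xs zs ys k : critical_point M f g xs zs ys ->
  lyapunov zs ys k.+2 + nsq (y k.+2 - y k.+1) + gamma ^+ 2 * nsq (z k.+2 - z k.+1)
    <= lyapunov zs ys k.+1.
Proof.
move=> [fs gs Mz].
have := subdiff_monotone pg (admm_subdiff_z k.+1) gs.
have := subdiff_monotone pg (admm_subdiff_z k.+1) (admm_subdiff_z k).
rewrite -mulmxN in fs.
have := subdiff_monotone pf (admm_subdiff_x k.+1) fs.
have [_ _ yE] := xzy k.+1.
have [r rE] : exists r, r = M *m x k.+2 - z k.+2 by eexists.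
rewrite -rE in yE.
rewrite -mulmxBr dot_trmxr mulmxBr.
have -> : M *m x k.+2 - M *m xs = r + (z k.+2 - zs).
  by rewrite rE; have /eqP := Mz; rewrite subr_eq0 => /eqP->; rewrite addrA subrK.
rewrite /lyapunov -[y k.+1 - ys](_ : y k.+2 - ys - gamma *: r = _); last first.
  by rewrite yE; vec_ring.
rewrite -[z k.+1 - zs](_ : z k.+2 - zs - (z k.+2 - z k.+1) = _); last by vec_ring.
have -> : - (y k.+2 + gamma *: (z k.+2 - z k.+1)) - - ys =
   - (y k.+2 - ys) - gamma *: (z k.+2 - z k.+1) by vec_ring.
have -> : y k.+2 - y k.+1 = gamma *: r by rewrite yE addrC addKr.
move: (z k.+2 - zs) (z k.+2 - z k.+1) (y k.+2 - ys) => b dz a.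
(* Up to the factor [2 * gamma], the descent amounts to [0 <= - dot a r - gamma * dot b dz]. By [h1]
   and [h3] the right side is at least [gamma * dot dz r], which [h2] makes nonnegative. *)
rewrite !dotE ?(dotC b a) ?(dotC r a) ?(dotC r dz) ?(dotC b dz) => h1 h2 h3.
have h4 : 0 <= gamma * (- dot a r - gamma * dot dz r - gamma * dot dz b).
  by rewrite mulr_ge0 ?(ltW gamma_gt0)//; lra.
have h5 : 0 <= gamma * (gamma * dot dz r) by rewrite mulr_ge0 ?(ltW gamma_gt0).
by lra.
Qed.

Lemma lyapunov_cvg xs zs ys : critical_point M f g xs zs ys ->
  nonincreasing_seq (fun k => lyapunov zs ys k.+1) /\
  cvgn (fun k => lyapunov zs ys k.+1).
Proof.
move=> cp; have ni : nonincreasing_seq (fun k => lyapunov zs ys k.+1).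
  apply/nonincreasing_seqP => k; have := lyapunov_descent k cp.
  have := nsq_ge0 (y k.+2 - y k.+1).
  by have := gamma2_nsq_ge0 (z k.+2 - z k.+1); lra.
split=> //; apply: nonincreasing_is_cvgn => //.
by exists 0 => _ [k _ <-]; exact: lyapunov_ge0.
Qed.

Lemma lyapunov_cvg0 zs ys : (fun k => lyapunov zs ys k.+1) @ \oo --> 0 ->
  (z @ \oo --> zs) /\ (y @ \oo --> ys).
Proof.
move=> l0; split; rewrite -cvg_shiftS; apply: cvg_nsq0.
  have l0' : (fun k => gamma ^- 2 * lyapunov zs ys k.+1) @ \oo --> 0.
    by rewrite -(mulr0 (gamma ^- 2)); apply: cvgM => //; exact: cvg_cst.
  apply: (squeeze_cvgr _ (cvg_cst 0) l0'); apply: nearW => k.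
  rewrite nsq_ge0 /= mulrC ler_pdivlMr ?exprn_gt0// mulrC /lyapunov.
  by rewrite lerDr nsq_ge0.
apply: (squeeze_cvgr _ (cvg_cst 0) l0); apply: nearW => k.
by rewrite nsq_ge0 /= /lyapunov lerDl gamma2_nsq_ge0.
Qed.

(** By [lyapunov_descent] the squared increments are dominated by differences of consecutive terms
    of a convergent sequence. *)
Lemma admm_increments_cvg0 xs zs ys : critical_point M f g xs zs ys ->
  (fun k => y k.+2 - y k.+1) @ \oo --> (0 : 'cV[R]_m) /\
  (fun k => z k.+2 - z k.+1) @ \oo --> (0 : 'cV[R]_m).
Proof.
move=> cp; have [_ cl] := lyapunov_cvg cp.
have d0 : (fun k => lyapunov zs ys k.+1 - lyapunov zs ys k.+2) @ \oo --> 0.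
  rewrite -(subrr (limn (fun k => lyapunov zs ys k.+1))).
  by apply: cvgB => //; rewrite (cvg_shiftS (fun k => lyapunov zs ys k.+1)).
have g0 : 0 < gamma ^- 2 by rewrite invr_gt0 exprn_gt0.
split; apply: cvg_nsq0.
  apply: (squeeze_cvgr _ (cvg_cst 0) d0); apply: nearW => k.
  by rewrite subr0 nsq_ge0 /=; have := lyapunov_descent k cp; have := gamma2_nsq_ge0 (z k.+2 - z k.+1); lra.
have d0' : (fun k => gamma ^- 2 * (lyapunov zs ys k.+1 - lyapunov zs ys k.+2)) @ \oo --> 0.
  by rewrite -(mulr0 (gamma ^- 2)); apply: cvgM => //; exact: cvg_cst.
apply: (squeeze_cvgr _ (cvg_cst 0) d0'); apply: nearW => k.
rewrite subr0 nsq_ge0 /= mulrC ler_pdivlMr ?exprn_gt0// mulrC.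
by have := lyapunov_descent k cp; have := nsq_ge0 (y k.+2 - y k.+1); lra.
Qed.

(** * Limits of the iterates *)

Lemma admm_residual k :
  M *m x k.+1 = z k.+1 + gamma^-1 *: (y k.+1 - y k).
Proof.
have [_ _ ->] := xzy k.
by rewrite [y k + _]addrC addrK scalerA mulVf ?gt_eqF// scale1r addrC subrK.
Qed.

Lemma admm_cvg : lower_semicontinuous f -> lower_semicontinuous g ->
  kernel_lineality M f -> (exists xs zs ys, critical_point M f g xs zs ys) ->
  exists (xs : 'cV[R]_n) (zs ys : 'cV[R]_m), critical_point M f g xs zs ys /\
    (z @ \oo --> zs) /\ (y @ \oo --> ys).
Proof.
move=> lf lg kl [xs [zs [ys cp]]].
have [U UU oU] := nat_ultra; have PU := @ultra_proper _ _ UU.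
have [dy dz] := admm_increments_cvg0 cp; have [ni _] := lyapunov_cvg cp.
have bnd k : lyapunov zs ys k.+1 <= lyapunov zs ys 1 by exact: (ni 0).
set L := lyapunov zs ys 1 in bnd.
have [k|y' yy'] := @bounded_ultra_cvg _ _ _ UU _ (fun k => y k.+1) (2 * L + 2 * nsq ys).
  apply: le_trans (nsqB_ge (y k.+1) ys) _; rewrite lerD2r ler_wpM2l//.
  by apply: le_trans (bnd k); rewrite lerDl gamma2_nsq_ge0.
have [k|z' zz'] := @bounded_ultra_cvg _ _ _ UU _ (fun k => z k.+1)
    (2 * (L / gamma ^+ 2) + 2 * nsq zs).
  apply: le_trans (nsqB_ge (z k.+1) zs) _; rewrite lerD2r ler_wpM2l//.
  rewrite ler_pdivlMr ?exprn_gt0// mulrC.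
  by apply: le_trans (bnd k); rewrite lerDr nsq_ge0.
have dyU : (fun k => y k.+2 - y k.+1) @ U --> (0 : 'cV[R]_m).
  exact: cvg_trans (cvg_app _ oU) dy.
have dzU : (fun k => z k.+2 - z k.+1) @ U --> (0 : 'cV[R]_m).
  exact: cvg_trans (cvg_app _ oU) dz.
(* Convergence along [U] does not pass to shifted sequences by itself; the vanishing increments
   supply it. *)
have yy'' : (fun k => y k.+2) @ U --> y'.
  rewrite (_ : (fun k => _) = fun k => y k.+1 + (y k.+2 - y k.+1)).
    by rewrite -[y']addr0; exact: cvgD.
  by apply/funext => k; rewrite addrC subrK.
have zz'' : (fun k => z k.+2) @ U --> z'.
  rewrite (_ : (fun k => _) = fun k => z k.+1 + (z k.+2 - z k.+1)).
    by rewrite -[z']addr0; exact: cvgD.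
  by apply/funext => k; rewrite addrC subrK.
have Mx : (fun k => M *m x k.+2) @ U --> z'.
  under eq_fun do rewrite admm_residual.
  have := cvgD zz'' (cvgZ (cvg_cst gamma^-1) dyU).
  by rewrite scaler0 addr0; apply.
have uu : (fun k => - (y k.+2 + gamma *: (z k.+2 - z k.+1))) @ U --> - y'.
  apply: cvgN; have := cvgD yy'' (cvgZ (cvg_cst gamma) dzU).
  by rewrite scaler0 addr0; apply.
have [x' Mx' fx'] := subdiff_image_closed UU pf lf cf kl Mx uu
  (fun k => admm_subdiff_x k.+1).
have cp' : critical_point M f g x' z' y'.
  split; last by rewrite Mx' subrr.
    by rewrite -mulmxN.
  by apply: (subdiff_closed _ pg lg zz' yy') => k; exact: admm_subdiff_z.
exists x', z', y'; split=> //; apply: lyapunov_cvg0.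
have [_ cl] := lyapunov_cvg cp'.
(* The Lyapunov function of the new critical point converges along [\oo], so its limit can be read
   along [U], where it is 0. *)
have clU : (fun k => lyapunov z' y' k.+1) @ U --> limn (fun k => lyapunov z' y' k.+1).
  exact: cvg_trans (cvg_app _ oU) cl.
have c0 : (fun k => lyapunov z' y' k.+1) @ U --> (0 : R).
  have -> : (0 : R) = dot (y' - y') (y' - y') + gamma ^+ 2 * dot (z' - z') (z' - z').
    by rewrite !subrr !dot0l mulr0 addr0.
  have cB N (u : nat -> 'cV[R]_N) (u' : 'cV[R]_N) : u @ U --> u' ->
      (fun k => u k - u') @ U --> u' - u'.
    by move=> uu'; apply: cvgB => //; exact: cvg_cst.
  apply: cvgD; first by apply: cvg_dot; exact: cB.
  by apply: cvgM; [exact: cvg_cst|apply: cvg_dot; exact: cB].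
by rewrite -(cvg_unique (@norm_hausdorff _ _) clU c0).
Qed.

Lemma admm_cvg_image xs zs ys : critical_point M f g xs zs ys ->
  z @ \oo --> zs -> y @ \oo --> ys -> (fun k => M *m x k) @ \oo --> M *m xs.
Proof.
move=> [_ _ Mz] zc yc; rewrite -cvg_shiftS.
under eq_fun do rewrite admm_residual.
have -> : M *m xs = zs + gamma^-1 *: (ys - ys).
  by rewrite subrr scaler0 addr0; apply/eqP; rewrite -subr_eq0 Mz.
apply: cvgD; first by rewrite cvg_shiftS.
by apply: cvgZ; [exact: cvg_cst|apply: cvgB => //; rewrite cvg_shiftS].
Qed.

Lemma admm_cvg_x xs zs ys : critical_point M f g xs zs ys ->
  z @ \oo --> zs -> y @ \oo --> ys -> (fun k => M *m x k) @ \oo --> M *m xs ->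
  strongly_convex f \/ M^T *m M \in unitmx -> x @ \oo --> xs.
Proof.
move=> [fs _ _] zc yc Mx [/(subdiff_strongly_monotone pf)[c c0 sm]|uM]; last first.
  have E w : w = invmx (M^T *m M) *m (M^T *m (M *m w)).
    by rewrite (mulmxA M^T) mulKmx.
  rewrite [xs]E (_ : x = fun k => invmx (M^T *m M) *m (M^T *m (M *m x k))).
    by do 2 apply: cvg_mulmx.
  by apply/funext => k; exact: E.
rewrite -cvg_shiftS; apply: cvg_nsq0; rewrite -mulmxN in fs.
(* Strong monotonicity bounds [c * nsq (x k.+1 - xs)] by [h k], where [x] enters only through its
   image by [M]. *)
pose h k := dot (M *m x k.+1 - M *m xs)
  (- (y k.+1 + gamma *: (z k.+1 - z k)) - - ys).
have h0 : (fun k => c^-1 * h k) @ \oo --> (0 : R).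
  rewrite -(mulr0 c^-1); apply: cvgM; first exact: cvg_cst.
  have Mx1 : (fun k => M *m x k.+1) @ \oo --> M *m xs.
    by rewrite (cvg_shiftS (fun k => M *m x k)).
  have y1 : (fun k => y k.+1) @ \oo --> ys by rewrite cvg_shiftS.
  have z1 : (fun k => z k.+1) @ \oo --> zs by rewrite cvg_shiftS.
  rewrite -(dot0l (- (ys + gamma *: (zs - zs)) - - ys)) -(subrr (M *m xs)).
  apply: cvg_dot; first by apply: cvgB => //; exact: cvg_cst.
  apply: cvgB; last exact: cvg_cst.
  apply: cvgN; apply: cvgD => //; apply: cvgZ; first exact: cvg_cst.
  exact: cvgB.
apply: (squeeze_cvgr _ (cvg_cst 0) h0); apply: nearW => k.
rewrite nsq_ge0 /= mulrC ler_pdivlMr// mulrC.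
by have := sm _ _ _ _ (admm_subdiff_x k) fs; rewrite -mulmxBr dot_trmxr mulmxBr.
Qed.

End admm_convergence.

Theorem corollary5p8 (R : realType) (m n : nat) (M : 'M[R]_(m, n))
  (f : 'cV[R]_n -> \bar R) (g : 'cV[R]_m -> \bar R)
  (hM : M <> 0)
  (f_proper : proper_fun f) (f_lsc : lower_semicontinuous f)
  (f_convex : convex_efun f)
  (g_proper : proper_fun g) (g_lsc : lower_semicontinuous g)
  (g_convex : convex_efun g)
  (hA :
    (* (A.1) *)
    (exists (xs : 'cV[R]_n) (zs ys : 'cV[R]_m), saddle_point M f g xs zs ys) \/
    (* (A.2) *)
    ((exists (xs : 'cV[R]_n) (zs : 'cV[R]_m), optimal_solution M f g xs zs) /\
     rel_interior (set_sub (edom g) [set M *m x | x in edom f]) 0))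
  (hB :
    (* (B.1) *)
    rel_interior (set_sub (edom (fenchel_conj f)) (mx_range M^T)) 0 \/
    (* (B.2) *)
    (rel_interior (set_ran (subdiff f)) `&` mx_range M^T !=set0) \/
    (* (B.3) *)
    (forall x : 'cV[R]_n,
      (mx_ker M `\` [set x | (- recession f (- x)%R = recession f x)%E /\
                             recession f x = 0%E]) x ->
      (0 < recession f x)%E) \/
    (* (B.4) *)
    coercive f \/
    (* (B.5) *)
    strongly_convex f \/
    (* (B.6) *)
    M^T *m M \in unitmx)
  (gamma : R) (gamma_gt0 : 0 < gamma)
  (x : nat -> 'cV[R]_n) (z y : nat -> 'cV[R]_m)
  (hadmm : admm M f g gamma x z y) :
  exists (xs : 'cV[R]_n) (zs ys : 'cV[R]_m),
    critical_point M f g xs zs ys /\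
    ((fun k => M *m x k) @ \oo --> M *m xs) /\
    (z @ \oo --> zs) /\
    (y @ \oo --> ys) /\
    optimal_solution M f g xs zs /\
    (strongly_convex f \/ M^T *m M \in unitmx -> x @ \oo --> xs).
Proof.
have kl : kernel_lineality M f.
  move: hB => [|[|[|[|[|]]]]].
  - exact: kernel_lineality_conj.
  - exact: kernel_lineality_ran_subdiff.
  - exact: kernel_lineality_recession.
  - exact: kernel_lineality_coercive.
  - exact: kernel_lineality_strongly_convex.
  - exact: kernel_lineality_unitmx.
have cp : exists xs zs ys, critical_point M f g xs zs ys.
  case: hA => [[xs [zs [ys sad]]]|[[xs [zs opt]] ri]].
    by exists xs, zs, ys; exact: saddle_critical.
  have [ys cp] := multiplier_exists f_proper f_lsc f_convex g_proper g_lsc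
    g_convex opt ri.
  by exists xs, zs, ys.
have [xs [zs [ys [cps [zc yc]]]]] := admm_cvg f_proper f_convex g_proper g_convex
  gamma_gt0 hadmm f_lsc g_lsc kl cp.
have Mx := admm_cvg_image gamma_gt0 hadmm cps zc yc.
exists xs, zs, ys; split=> //; split=> //; split=> //; split=> //; split.
  exact: critical_optimal cps.
exact: (admm_cvg_x f_proper f_convex hadmm cps zc yc Mx).
Qed.
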